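(* Consider a geometrically consistent dimer model on a torus and let $f$ be a face of the universal cover $\widetilde{Q}$ of its quiver. Two rays $\gamma^+$ and $\gamma^-$ span a two dimensional cone in the local zig-zag fan $\xi(f)$ if and only if they have representative zig-zag flows $\widetilde{\eta}^+$ and $\widetilde{\eta}^-$ which intersect each other in the boundary of $f$.
   Context: **Dimer model and quiver.** A dimer model on a torus $T$ is a finite bipartite tiling of $T$: a finite polygonal cell decomposition whose vertices (all of valence at least 2) are coloured black and white so that every edge joins a black vertex to a white vertex. The associated quiver $Q$ is the dual cell decomposition: its set of vertices $Q_0$ is dual to the tiles, its set of arrows $Q_1$ is dual to the edges, and its set of faces $Q_2$ is dual to the dimer vertices; each arrow is oriented so that the black dimer vertex is on its left and the white one on its right. Faces dual to black (white) vertices are called black (white) faces. An arrow $a$ has tail $ta$ and head $ha$. $\widetilde{Q}$ denotes the lift of $Q$ to the universal cover (the plane) of $T$. Write $H_1(Q)=H_1(T;\mathbb{Z})$. **Geometric consistency.** The quad graph is the tiling of $T$ whose vertices are the dimer vertices together with the quiver vertices, with edges connecting a dimer vertex $f$ to a quiver vertex $v$ when the quiver face dual to $f$ has $v$ in its boundary; its faces are quadrilaterals (quads), in bijection with $Q_1$, the quad of $a$ having as its corners $ta$, $ha$ and the two dimer vertices joined by the edge dual to $a$. The dimer model is geometrically consistent if, for some flat metric on the torus, its quad graph has a rhombic embedding, i.e. an embedding in the torus such that all edges are line segments of the same length. **Zig-zag flows.** A zig-zag flow is a map $\widetilde{\eta}:\mathbb{Z}\to\widetilde{Q}_1$ such that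 for every $n$: $h\widetilde{\eta}_n=t\widetilde{\eta}_{n+1}$; $\widetilde{\eta}_{2n},\widetilde{\eta}_{2n+1}$ are in the boundary of the same black face; $\widetilde{\eta}_{2n-1},\widetilde{\eta}_{2n}$ are in the boundary of the same white face. Flows are considered up to shifting the index by an even integer. Projecting to $Q$ gives a periodic zig-zag path $\eta$; $[\eta]\in H_1(Q)$ is the class of the cycle given by the sum of its arrows over a single period. For a geometrically consistent dimer model $[\eta]$ is non-zero and primitive. Flows intersect (each other, or the boundary of a face) when they have an arrow in common (with it). **Local zig-zag fan.** For a face $f$ of $\widetilde{Q}$, let $\mathcal{X}(f)$ be the set of zig-zag flows which intersect the boundary of $f$. The local zig-zag fan $\xi(f)$ is the complete fan of strongly convex rational polyhedral cones in $H_1(Q)\otimes_{\mathbb{Z}}\mathbb{R}$ whose rays are generated by the classes $[\eta]$ for $\widetilde{\eta}\in\mathcal{X}(f)$. A representative zig-zag flow of a ray $\gamma$ is a zig-zag flow $\widetilde{\eta}$ with $[\eta]$ the primitive generator of $\gamma$. *)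

(* Defs.v *)
From HB Require Import structures.
From mathcomp Require Import all_boot all_order all_algebra.
From mathcomp Require Import all_classical all_reals.
From mathcomp Require Import generic_quotient ring_quotient.

Set Implicit Arguments.
Unset Strict Implicit.
Unset Printing Implicit Defensive.

Import Order.TTheory GRing.Theory Num.Theory.

Local Open Scope classical_set_scope.
Local Open Scope quotient_scope.
Local Open Scope ring_scope.

(* The quiver of a dimer model, as a cell decomposition of an oriented surface
   given by its combinatorial map.  V = Q_0 (dual to the tiles), A = Q_1 (dual
   to the edges), B and W are the black and the white faces (dual to the dimer
   vertices).  Every arrow has one black face on its left and one white face on
   its right, so the boundary of a black (white) face is an oriented cycle of
   arrows, traversed anticlockwise (clockwise); nextB (nextW) is the successor
   of an arrow along it.  Around a vertex, the incoming arrows are permuted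
   cyclically (clockwise) by prevW \o nextB.  Faces and vertices are in
   bijection with the corresponding orbits, and these are finite, since the
   ..._orbit fields use non-negative iterates only.  The carriers are arbitrary
   types because the universal cover is infinite. *)
Record surface_quiver (V A B W : Type) := SurfaceQuiver {
  tl : A -> V;
  hd : A -> V;
  bface : A -> B;
  wface : A -> W;
  nextB : A -> A;
  prevB : A -> A;
  nextW : A -> A;
  prevW : A -> A;
  nextBK : cancel nextB prevB;
  prevBK : cancel prevB nextB;
  nextWK : cancel nextW prevW;
  prevWK : cancel prevW nextW;
  tl_nextB : forall a, tl (nextB a) = hd a;
  tl_nextW : forall a, tl (nextW a) = hd a;
  bface_orbit : forall a a',
    bface a = bface a' <-> exists n, a' = iter n nextB a;
  wface_orbit : forall a a',
    wface a = wface a' <-> exists n, a' = iter n nextW a;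
  hd_orbit : forall a a',
    hd a = hd a' <-> exists n, a' = iter n (prevW \o nextB) a;
  hd_surj : forall v, exists a, hd a = v;
  bface_surj : forall b, exists a, bface a = b;
  wface_surj : forall w, exists a, wface a = w
}.

Section Walks.
Variables (V A B W : Type) (Q : surface_quiver V A B W).

Definition in_boundary (f : B + W) (a : A) : Prop :=
  match f with
  | inl b => bface Q a = b
  | inr w => wface Q a = w
  end.

(* (a, true) is the arrow a, (a, false) its formal inverse. *)
Definition dart : Type := A * bool.
Definition dart_src (d : dart) := if d.2 then tl Q d.1 else hd Q d.1.
Definition dart_tgt (d : dart) := if d.2 then hd Q d.1 else tl Q d.1.
Definition dart_inv (d : dart) : dart := (d.1, ~~ d.2).

Fixpoint walk (x : V) (s : seq dart) (y : V) : Prop :=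
  if s is d :: s' then dart_src d = x /\ walk (dart_tgt d) s' y else x = y.

Definition connected_quiver := forall x y, exists s, walk x s y.

(* Homotopy of walks starting at x: generated by the insertion and deletion of
   backtrackings and of boundaries of faces. *)
Inductive homotopic (x : V) : seq dart -> seq dart -> Prop :=
| homotopic_refl s : homotopic x s s
| homotopic_sym s1 s2 : homotopic x s1 s2 -> homotopic x s2 s1
| homotopic_trans s1 s2 s3 :
    homotopic x s1 s2 -> homotopic x s2 s3 -> homotopic x s1 s3
| homotopic_cancel s1 d s2 : walk x s1 (dart_src d) ->
    homotopic x (s1 ++ d :: dart_inv d :: s2) (s1 ++ s2)
| homotopic_black s1 a n s2 : walk x s1 (tl Q a) -> iter n (nextB Q) a = a ->
    homotopic x (s1 ++ [seq (b, true) | b <- traject (nextB Q) a n] ++ s2)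
                (s1 ++ s2)
| homotopic_white s1 a n s2 : walk x s1 (tl Q a) -> iter n (nextW Q) a = a ->
    homotopic x (s1 ++ [seq (b, true) | b <- traject (nextW Q) a n] ++ s2)
                (s1 ++ s2).

Definition simply_connected_quiver :=
  connected_quiver /\ forall x s, walk x s x -> homotopic x s [::].

End Walks.

(* A finite connected cell decomposition of a closed oriented surface; the
   surface is a torus iff the Euler characteristic is 0.  The valence of a dimer
   vertex is the length of the boundary of the dual face. *)
Definition dimer_model_on_torus (V A B W : finType)
    (Q : surface_quiver V A B W) : Prop :=
  [/\ (0 < #|A|)%N, connected_quiver Q,
      (#|V| + #|{: B + W}| = #|A|)%N,
      forall a, nextB Q a <> a & forall a, nextW Q a <> a].

Record quiver_map (V A B W V' A' B' W' : Type)
    (Q' : surface_quiver V' A' B' W') (Q : surface_quiver V A B W) :=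
  QuiverMap {
  mapV : V' -> V;
  mapA : A' -> A;
  mapB : B' -> B;
  mapW : W' -> W;
  map_tl : forall a, tl Q (mapA a) = mapV (tl Q' a);
  map_hd : forall a, hd Q (mapA a) = mapV (hd Q' a);
  map_bface : forall a, bface Q (mapA a) = mapB (bface Q' a);
  map_wface : forall a, wface Q (mapA a) = mapW (wface Q' a);
  map_nextB : forall a, nextB Q (mapA a) = mapA (nextB Q' a);
  map_nextW : forall a, nextW Q (mapA a) = mapA (nextW Q' a)
}.

Section Coverings.
Variables (V A B W V' A' B' W' : Type).
Variables (Q' : surface_quiver V' A' B' W') (Q : surface_quiver V A B W).

Definition covering (p : quiver_map Q' Q) : Prop :=
  [/\ forall v a, tl Q a = mapV p v -> exists! a', tl Q' a' = v /\ mapA p a' = a,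
      forall v a, hd Q a = mapV p v -> exists! a', hd Q' a' = v /\ mapA p a' = a,
      forall b a, bface Q a = mapB p b ->
        exists! a', bface Q' a' = b /\ mapA p a' = a
    & forall w a, wface Q a = mapW p w ->
        exists! a', wface Q' a' = w /\ mapA p a' = a].

Definition universal_cover (p : quiver_map Q' Q) : Prop :=
  covering p /\ simply_connected_quiver Q'.

End Coverings.

Section QuadGraph.
Variables (V A B W : Type) (Q : surface_quiver V A B W).

Definition quad_vertex : Type := V + (B + W).

(* The edges of the quad graph are the corners of the faces of the quiver: the
   corner of bface a (wface a) at hd a lies between a and nextB a (nextW a). *)
Inductive quad_cell : Type :=
| QVertex of quad_vertex
| QEdgeB of A
| QEdgeW of A
| QQuad of A.

(* Corners are listed anticlockwise for a quad: the black vertex is on the left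
   of the arrow, the white one on the right. *)
Definition corners (c : quad_cell) : seq quad_vertex :=
  match c with
  | QVertex x => [:: x]
  | QEdgeB a => [:: inl (hd Q a); inr (inl (bface Q a))]
  | QEdgeW a => [:: inl (hd Q a); inr (inr (wface Q a))]
  | QQuad a => [:: inl (tl Q a); inr (inr (wface Q a));
                   inl (hd Q a); inr (inl (bface Q a))]
  end.

End QuadGraph.

Section Plane.
Variable R : realType.

Definition plane : Type := (R^o * R^o)%type.

Definition edist (x y : plane) : R :=
  Num.sqrt ((x.1 - y.1) ^+ 2 + (x.2 - y.2) ^+ 2).

Definition det2 (x y : plane) : R := x.1 * y.2 - x.2 * y.1.

(* Relative interior of the convex hull of a list of points: a point, an open
   segment, or an open quadrangle. *)
Definition open_hull (s : seq plane) : set plane :=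
  [set x | exists c : 'I_(size s) -> R,
     [/\ forall i, 0 < c i, \sum_i c i = 1 & x = \sum_i c i *: s`_i]].

End Plane.

Section GeometricConsistency.
Variables (R : realType) (V A B W V' A' B' W' : Type).
Variables (Q' : surface_quiver V' A' B' W') (Q : surface_quiver V A B W).
Variable p : quiver_map Q' Q.

Definition cell_image (pos : quad_vertex V' B' W' -> plane R)
    (c : quad_cell V' A' B' W') : set (plane R) :=
  open_hull [seq pos x | x <- corners Q' c].

Definition translated_quad (pos : quad_vertex V' B' W' -> plane R)
    (a a' : A') (l : plane R) : Prop :=
  [seq pos x | x <- corners Q' (QQuad V' B' W' a')] =
  [seq pos x + l | x <- corners Q' (QQuad V' B' W' a)].

(* A rhombic embedding of the quad graph in the flat torus R^2 / (Z e1 + Z e2),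
   lifted to an embedding pos of the universal cover in R^2.
   - The cells of the lifted tiling have pairwise disjoint images, and each quad
     is a non-degenerate, positively oriented rhombus; composing with a
     reflection of R^2 shows that preserving the orientation is no restriction.
   - Lifts of the same cell are exactly the translates by lattice vectors, so
     that pos descends to an embedding of the torus in the flat torus. *)
Definition rhombic_embedding (e1 e2 : plane R) (len : R)
    (pos : quad_vertex V' B' W' -> plane R) : Prop :=
  [/\ (forall a, edist (pos (inl (hd Q' a))) (pos (inr (inl (bface Q' a)))) = len
              /\ edist (pos (inl (hd Q' a))) (pos (inr (inr (wface Q' a)))) = len),
      (forall a, 0 < det2 (pos (inr (inr (wface Q' a))) - pos (inl (tl Q' a)))
                          (pos (inr (inl (bface Q' a))) - pos (inl (tl Q' a)))),
      (forall c c', c <> c' -> cell_image pos c `&` cell_image pos c' = set0),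
      (forall a a', mapA p a = mapA p a' ->
         exists m n : int, translated_quad pos a a' (e1 *~ m + e2 *~ n))
    & (forall a (m n : int), exists a',
         mapA p a' = mapA p a /\ translated_quad pos a a' (e1 *~ m + e2 *~ n))].

Definition geometrically_consistent : Prop :=
  exists (e1 e2 : plane R) (len : R) (pos : quad_vertex V' B' W' -> plane R),
    det2 e1 e2 != 0 /\ rhombic_embedding e1 e2 len pos.

End GeometricConsistency.

Section VectQuotient.
Variables (K : fieldType) (V : vectType K) (U : {vspace V}).
Definition vquot : Type := Quotient.quot (pred_of_vspace U).
HB.instance Definition _ := GRing.Zmodule.on vquot.
HB.instance Definition _ := Quotient.on vquot.

Definition vquot_pi (x : V) : vquot := \pi_(Quotient.quot (pred_of_vspace U)) x.

Lemma vquot_pi_eq x y : (vquot_pi x == vquot_pi y) = (x - y \in U).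
Proof. by rewrite [RHS]Quotient.idealrBE. Qed.

Lemma vquot_piD x y : vquot_pi (x + y) = vquot_pi x + vquot_pi y.
Proof. exact: Quotient.pi_add. Qed.

Lemma vquot_reprK (x : vquot) : vquot_pi (repr x) = x.
Proof. exact: reprK. Qed.

Definition vquot_scale (k : K) (x : vquot) : vquot := vquot_pi (k *: repr x).

Lemma vquot_piZ k x : vquot_pi (k *: x) = vquot_scale k (vquot_pi x).
Proof.
apply/eqP; rewrite vquot_pi_eq -scalerBr memvZ // -vquot_pi_eq.
by rewrite vquot_reprK.
Qed.

Fact vquot_scaleA a b x :
  vquot_scale a (vquot_scale b x) = vquot_scale (a * b) x.
Proof. by rewrite -[x]vquot_reprK -!vquot_piZ scalerA. Qed.

Fact vquot_scale1 : left_id 1 vquot_scale.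
Proof. by move=> x; rewrite -[x]vquot_reprK -vquot_piZ scale1r. Qed.

Fact vquot_scaleDr : right_distributive vquot_scale +%R.
Proof.
move=> a x y; rewrite -[x]vquot_reprK -[y]vquot_reprK.
by rewrite -vquot_piD -!vquot_piZ scalerDr vquot_piD.
Qed.

Fact vquot_scaleDl x : {morph vquot_scale^~ x : a b / a + b}.
Proof.
move=> a b; rewrite -[x]vquot_reprK.
by rewrite -!vquot_piZ scalerDl vquot_piD.
Qed.

HB.instance Definition _ := GRing.Zmodule_isLmodule.Build K vquot
  vquot_scaleA vquot_scale1 vquot_scaleDr vquot_scaleDl.

Fact vquot_pi_is_linear : linear vquot_pi.
Proof. by move=> a x y; rewrite vquot_piD vquot_piZ. Qed.

HB.instance Definition _ := GRing.isLinear.Build K V vquot _ vquot_pi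
  vquot_pi_is_linear.

(* A complement of U provides coordinates. *)
Fact vquot_vect_iso : Vector.axiom (\dim (U^C)%VS) vquot.
Proof.
pose q (x : vquot) := vsproj (U^C)%VS (daddv_pi (U^C)%VS U (repr x)).
have dUC : (U^C :&: U = 0)%VS by rewrite capvC capv_compl.
have q_pi x : q (vquot_pi x) = vsproj (U^C)%VS (daddv_pi (U^C)%VS U x).
  apply/eqP; rewrite /q -subr_eq0 -!linearB /=.
  have /eqP : vquot_pi (repr (vquot_pi x)) = vquot_pi x by rewrite vquot_reprK.
  rewrite vquot_pi_eq => xU.
  have -> : daddv_pi (U^C)%VS U (repr (vquot_pi x) - x) = 0; last by rewrite linear0.
  have dUC' : (U :&: U^C = 0)%VS by rewrite capvC.
  have xUC : repr (vquot_pi x) - x \in (U^C + U)%VS.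
    by rewrite addvC addv_complf memvf.
  have := daddv_pi_add dUC xUC.
  by rewrite [daddv_pi U _ _](daddv_pi_id dUC' xU) -[RHS]add0r => /addIr.
have q_lin : linear q.
  move=> a x y; rewrite -[x]vquot_reprK -[y]vquot_reprK -linearP !q_pi.
  by rewrite !linearP.
have qK : cancel q (fun u => vquot_pi (vsval u)).
  move=> x; rewrite -[x]vquot_reprK q_pi vsprojK ?memv_pi //.
  apply/eqP; rewrite vquot_pi_eq -memvN opprB.
  have xUC : repr x \in (U^C + U)%VS by rewrite addvC addv_complf memvf.
  rewrite -{1}(daddv_pi_add dUC xUC) addrC addKr.
  exact: memv_pi.
have Kq : cancel (fun u => vquot_pi (vsval u)) q.
  move=> u; rewrite q_pi daddv_pi_id ?subvsP //.
  exact: vsvalK.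
have [f f_lin f_bij] := @subvs_vect_iso _ _ (U^C)%VS.
exists (f \o q); first by move=> a x y /=; rewrite q_lin f_lin.
by apply: bij_comp => //; exists (fun u => vquot_pi (vsval u)).
Qed.

HB.instance Definition _ := Lmodule_hasFinDim.Build K vquot vquot_vect_iso.
End VectQuotient.

(* Cellular homology with real coefficients, i.e. H_1(Q) tensored with R.  As
   H_1 of a torus is torsion free, H_1(Q) itself is the lattice of the classes
   of integral cycles. *)
Section Homology.
Variables (R : realType) (V A B W : finType) (Q : surface_quiver V A B W).

Definition arrow_chain (a : A) : {ffun A -> R^o} := [ffun b => (b == a)%:R].

Definition boundary1 (c : {ffun A -> R^o}) : {ffun V -> R^o} :=
  [ffun v => \sum_(a | hd Q a == v) c a - \sum_(a | tl Q a == v) c a].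

Fact boundary1_is_linear : linear boundary1.
Proof.
move=> k c d; apply/ffunP => v; rewrite !ffunE.
have E P : \sum_(a | P a) (k *: c + d) a =
    k *: (\sum_(a | P a) c a) + \sum_(a | P a) d a.
  by rewrite scaler_sumr -big_split; apply: eq_bigr => a _; rewrite !ffunE.
by rewrite !E opprD addrACA scalerBr.
Qed.

HB.instance Definition _ :=
  GRing.isLinear.Build R {ffun A -> R^o} {ffun V -> R^o} _ boundary1
    boundary1_is_linear.

Definition face_chain (f : B + W) : {ffun A -> R^o} :=
  match f with
  | inl b => \sum_(a | bface Q a == b) arrow_chain a
  | inr w => - \sum_(a | wface Q a == w) arrow_chain a
  end.

Definition cycles : {vspace {ffun A -> R^o}} := lker (linfun boundary1).

Definition boundaries : {vspace {ffun A -> R^o}} :=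
  <<[seq face_chain f | f : B + W]>>%VS.

Definition homology1 : vectType R :=
  vquot (linfun (vsval : subvs_of cycles -> _) @^-1: boundaries)%VS.

(* Meaningful for cycles only; vsproj is the identity on these. *)
Definition homology_class (c : {ffun A -> R^o}) : homology1 :=
  vquot_pi _ (vsproj cycles c).

Definition integral_class (u : homology1) : Prop :=
  exists c : {ffun A -> int},
    let cR : {ffun A -> R^o} := [ffun a => (c a)%:~R] in
    cR \in cycles /\ u = homology_class cR.

End Homology.

Section Fans.
Variables (R : realType) (H : vectType R) (L : H -> Prop).
Implicit Types (s t : set H) (S : set (set H)).

Definition cone_of (g : seq H) : set H :=
  [set x | exists c : 'I_(size g) -> R,
     (forall i, 0 <= c i) /\ x = \sum_i c i *: g`_i].

Definition rational_polyhedral s : Prop :=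
  exists g : seq H, (forall u, u \in g -> L u) /\ s = cone_of g.

Definition strongly_convex s : Prop := forall x, s x -> s (- x) -> x = 0.

Definition cone_dim s (n : nat) : Prop :=
  exists g : seq H, s = cone_of g /\ \dim <<g>> = n.

Definition cone_face t s : Prop :=
  exists m : 'Hom(H, R^o),
    (forall x, s x -> 0 <= m x) /\ t = [set x | s x /\ m x = 0].

Definition fan S : Prop :=
  [/\ finite_set S,
      forall s, S s -> rational_polyhedral s /\ strongly_convex s,
      forall s t, S s -> cone_face t s -> S t
    & forall s t, S s -> S t ->
        cone_face (s `&` t) s /\ cone_face (s `&` t) t].

Definition complete S : Prop := forall x, exists s, S s /\ s x.

Definition ray s : Prop :=
  [/\ rational_polyhedral s, strongly_convex s & cone_dim s 1].

Definition primitive_generator s (u : H) : Prop :=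
  [/\ L u, u <> 0, s = cone_of [:: u]
    & forall (k : nat) (v : H), L v -> u = v *+ k -> k = 1%N].

Definition span_2dim_cone S s t : Prop :=
  let st : set H := [set x | exists y z, [/\ s y, t z & x = y + z]] in
  S st /\ cone_dim st 2.

End Fans.

(* Flows are taken as maps; passing to classes under even shifts of the index
   changes none of the notions below. *)
Definition zigzag_flow (V' A' B' W' : Type) (Q' : surface_quiver V' A' B' W')
    (eta : int -> A') : Prop :=
  forall n : int,
    [/\ hd Q' (eta n) = tl Q' (eta (n + 1)),
        bface Q' (eta (2 * n)) = bface Q' (eta (2 * n + 1))
      & wface Q' (eta (2 * n - 1)) = wface Q' (eta (2 * n))].

Section LocalFan.
Variables (R : realType) (V A B W : finType) (V' A' B' W' : Type).
Variables (Q' : surface_quiver V' A' B' W') (Q : surface_quiver V A B W).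
Variable p : quiver_map Q' Q.

Definition flow_period (eta : int -> A') (m : nat) : Prop :=
  (0 < m)%N /\ forall n : int, mapA p (eta (n + m%:Z)) = mapA p (eta n).

Definition flow_class (eta : int -> A') (u : homology1 R Q) : Prop :=
  exists m : nat,
    [/\ flow_period eta m, forall k, flow_period eta k -> (m <= k)%N
      & u = homology_class Q (\sum_(i < m) arrow_chain R (mapA p (eta i%:Z)))].

Definition meets_boundary (f : B' + W') (eta : int -> A') : Prop :=
  exists n, in_boundary Q' f (eta n).

(* In a plane a complete fan is determined by its rays. *)
Definition local_zigzag_fan (f : B' + W') (S : set (set (homology1 R Q))) : Prop :=
  [/\ fan (@integral_class R V A B W Q) S, complete S
    & forall s, (S s /\ cone_dim s 1) <->
        exists eta u, [/\ zigzag_flow Q' eta, meets_boundary f eta,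
          flow_class eta u & s = cone_of [:: u]]].

Definition representative_flow (s : set (homology1 R Q)) (eta : int -> A') : Prop :=
  zigzag_flow Q' eta /\
  exists u, flow_class eta u /\
            primitive_generator (@integral_class R V A B W Q) s u.

Definition intersect_in_boundary (f : B' + W') (eta theta : int -> A') : Prop :=
  exists a, [/\ in_boundary Q' f a, exists n, eta n = a & exists n, theta n = a].

End LocalFan.

(* Main.v *)
Require Import Defs.
From HB Require Import structures.
From mathcomp Require Import all_boot all_order all_algebra.
From mathcomp Require Import all_classical all_reals.
From mathcomp Require Import ring lra zify.

(* In the rhombic embedding the quad of an arrow [a] is spanned by the sides
   X a = w - t and Y a = b - t, and the quads along a zig-zag flow share parallel
   sides: X is the same vector at all even arrows and -Y at all odd ones.  Call it
   the direction of the flow.  Every crossing of two flows has the sign of the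
   determinant of their directions, so the intersection number of two flows has
   this sign, or vanishes when they do not meet in the torus.  As H_1 is two
   dimensional, intersection numbers are a positive multiple of an area form, so
   that two flows whose classes form a positive basis have directions forming a
   positive basis.  The flows meeting a face f have as directions the vectors
   joining f to its corners; since the quads around f do not overlap, no such
   direction lies between those of two consecutive corners, and by the sign rule
   the same holds for the classes.  Hence flows through consecutive corners, i.e.
   those which meet in an arrow of f, span the two dimensional cones. *)

Set Implicit Arguments.
Unset Strict Implicit.
Unset Printing Implicit Defensive.

Import Order.TTheory GRing.Theory Num.Theory.

Local Open Scope classical_set_scope.
Local Open Scope ring_scope.

(** * Polyhedral cones in a plane *)

Section Cones.
Variables (R : realType) (H : vectType R).
Implicit Types (g : seq H) (x u v w : H).

Lemma cone_of_nil x : cone_of [::] x <-> x = 0.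
Proof.
split=> [[c [_ ->]]|->]; first by rewrite big_ord0.
by exists (fun=> 0); rewrite big_ord0.
Qed.

Lemma cone_of_cons w g x :
  cone_of (w :: g) x <-> exists c y, [/\ 0 <= c, cone_of g y & x = c *: w + y].
Proof.
split=> [[c [c0 ->]]|[c [_ [c0 [d [d0 ->]] ->]]]].
  exists (c ord0), (\sum_(i < size g) c (lift ord0 i) *: g`_i).
  split=> //; last by rewrite big_ord_recl.
  by exists (fun i => c (lift ord0 i)).
exists (fun i => if unlift ord0 i is Some j then d j else c).
split; first by move=> i; case: unliftP.
rewrite big_ord_recl unlift_none; congr (_ + _).
by apply: eq_bigr => i _; rewrite liftK.
Qed.

Lemma cone_of1 u x : cone_of [:: u] x <-> exists c, 0 <= c /\ x = c *: u.
Proof.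
split=> [/cone_of_cons[c [y [c0 /cone_of_nil-> ->]]]|[c [c0 ->]]].
  by exists c; rewrite addr0.
by apply/cone_of_cons; exists c, 0; split=> //; [exact/cone_of_nil | rewrite addr0].
Qed.

Lemma cone_of2 u v x :
  cone_of [:: u; v] x <-> exists b c, [/\ 0 <= b, 0 <= c & x = b *: u + c *: v].
Proof.
split=> [/cone_of_cons[b [y [b0 /cone_of1[c [c0 ->]] ->]]]|[b [c [b0 c0 ->]]]].
  by exists b, c.
by apply/cone_of_cons; exists b, (c *: v); split=> //; apply/cone_of1; exists c.
Qed.

Lemma cone_of_sub g x : x \in g -> cone_of g x.
Proof.
elim: g => // w g IHg; rewrite inE => /orP[/eqP->|/IHg gx]; apply/cone_of_cons.
  exists 1, 0; rewrite scale1r addr0; split=> //.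
  by exists (fun=> 0); split=> //; rewrite big1 // => i _; rewrite scale0r.
by exists 0, x; rewrite scale0r add0r.
Qed.

Lemma cone_of_span g x : cone_of g x -> x \in <<g>>%VS.
Proof.
by case=> c [_ ->]; apply: memv_suml => i _; rewrite memvZ ?memv_span ?mem_nth.
Qed.

Lemma cone_of_add u v :
  [set x | exists y z, [/\ cone_of [:: u] y, cone_of [:: v] z & x = y + z]] =
  cone_of [:: u; v].
Proof.
apply/seteqP; split=> x /=.
  move=> [_ [_ [/cone_of1[b [b0 ->]] /cone_of1[c [c0 ->]] ->]]].
  by apply/cone_of2; exists b, c.
move=> /cone_of2[b [c [b0 c0 ->]]]; exists (b *: u), (c *: v).
by split=> //; apply/cone_of1; [exists b | exists c].
Qed.

Lemma cone_of_swap u v : cone_of [:: u; v] = cone_of [:: v; u].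
Proof.
by apply/seteqP; split=> x /cone_of2[b [c [b0 c0 ->]]]; apply/cone_of2;
  exists c, b; rewrite addrC.
Qed.

Lemma cone_of1_scale (c : R) u : 0 < c -> cone_of [:: c *: u] = cone_of [:: u].
Proof.
move=> c0; apply/seteqP; split=> x /cone_of1[b [b0 ->]]; apply/cone_of1.
  by exists (b * c); rewrite scalerA mulr_ge0 // ltW.
by exists (b / c); rewrite scalerA divfK ?gt_eqF // divr_ge0 // ltW.
Qed.

End Cones.

(** * Cones in a plane with an area form *)

Section PlanarCones.
Variables (R : realType) (H : vectType R) (J0 J1 : 'Hom(H, R^o)).
Hypothesis J_inj : forall x, J0 x = 0 -> J1 x = 0 -> x = 0.
Implicit Types (g : seq H) (x y z u v w : H).

(** The area form in the coordinates [J0], [J1], packaged as a linear form in its second argument so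
    that it can serve as the functional cutting out a face. *)
Definition wedge x : 'Hom(H, R^o) := (J0 x : R) *: J1 - (J1 x : R) *: J0.

Lemma wedgeE x y : wedge x y = (J0 x : R) * J1 y - (J1 x : R) * J0 y :> R.
Proof. by rewrite /wedge add_lfunE opp_lfunE !scale_lfunE. Qed.

Lemma wedgexx x : wedge x x = 0.
Proof. by rewrite wedgeE mulrC subrr. Qed.

Lemma wedgeC x y : wedge x y = - wedge y x.
Proof. by rewrite !wedgeE opprB mulrC [X in _ - X]mulrC. Qed.

Lemma wedgeZ x (c : R) y : wedge x (c *: y) = c * wedge x y :> R.
Proof. by rewrite linearZ. Qed.

Lemma wedgeZl (c : R) x y : wedge (c *: x) y = c * wedge x y :> R.
Proof. by rewrite wedgeC wedgeZ wedgeC mulrN opprK. Qed.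

Lemma wedgeD x y z : wedge x (y + z) = wedge x y + wedge x z.
Proof. by rewrite linearD. Qed.

Lemma wedgeDl x y z : wedge (x + y) z = wedge x z + wedge y z.
Proof. by rewrite wedgeC wedgeD opprD -!wedgeC. Qed.

(** The two sides have the same coordinates by polynomial identities, and [J0], [J1] jointly
    separate points. *)
Lemma cramer x y z :
  (wedge x y : R) *: z = (wedge z y : R) *: x + (wedge x z : R) *: y.
Proof.
apply/eqP; rewrite -subr_eq0; apply/eqP.
by apply: J_inj; rewrite linearB linearD !linearZ /= !wedgeE /GRing.scale /=; ring.
Qed.

Lemma wedge_eq0 x y : x != 0 -> wedge x y = 0 -> exists c : R, y = c *: x.
Proof.
move=> x0; rewrite wedgeE => xy.
have [J0x|J0x] := eqVneq (J0 x : R) 0.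
  have J1x : J1 x != 0 :> R.
    by apply: contra_neq x0 => J1x; apply: J_inj.
  exists (J1 y / J1 x : R); apply/eqP; rewrite -subr_eq0; apply/eqP.
  apply: J_inj; rewrite linearB linearZ /= /GRing.scale /=; last by field.
  rewrite J0x in xy *; rewrite mulr0 subr0; apply/eqP.
  by move: xy; rewrite mul0r sub0r => /eqP; rewrite oppr_eq0 mulf_eq0 (negbTE J1x).
exists (J0 y / J0 x : R); apply/eqP; rewrite -subr_eq0; apply/eqP.
apply: J_inj; rewrite linearB linearZ /= /GRing.scale /=; first by field.
by apply: (mulfI J0x); rewrite mulr0 -xy; field.
Qed.

Lemma wedge_free u v : wedge u v != 0 -> \dim <<[:: u; v]>> = 2.
Proof.
move=> uv; suff : free [:: u; v] by move/eqP.
rewrite free_cons; apply/andP; split; last first.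
  by rewrite seq1_free; apply: contra_neq uv => ->; rewrite linear0.
apply: contraNN uv; rewrite span_seq1 => /vlineP[c ->].
by rewrite wedgeZl wedgexx mulr0.
Qed.

(** Up to the positive factor [wedge u v], the two wedges are the Cramer coordinates of [x] in the
    basis [u], [v]. *)
Lemma mem_cone2 u v x : 0 < wedge u v :> R ->
  cone_of [:: u; v] x <-> 0 <= wedge u x :> R /\ 0 <= wedge x v :> R.
Proof.
move=> uv; split=> [/cone_of2[b [c [b0 c0 ->]]]|[ux xv]].
  rewrite wedgeD wedgeDl !wedgeZ !wedgeZl !wedgexx !mulr0 add0r addr0.
  by rewrite !mulr_ge0 // ltW.
apply/cone_of2; exists (wedge x v / wedge u v : R), (wedge u x / wedge u v : R).
split; rewrite ?divr_ge0 // ?(ltW uv) //.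
apply: (@scalerI _ _ (wedge u v : R)); first by rewrite gt_eqF.
by rewrite cramer scalerDr !scalerA ![wedge u v * _]mulrC !divfK ?gt_eqF.
Qed.

(** Induction on the generators. A new generator [w] lies in the cone found so far or becomes an
    edge of a larger one; in the remaining position [- w] lies in the old cone, which strong
    convexity forbids for non-zero [w]. *)
Lemma strongly_convex_cone_of g : strongly_convex (cone_of g) ->
  [\/ cone_of g = [set 0],
      exists2 u, u != 0 & cone_of g = cone_of [:: u]
    | exists u v, 0 < wedge u v :> R /\ cone_of g = cone_of [:: u; v]].
Proof.
elim: g => [|w g IHg] scg.
  by constructor 1; apply/seteqP; split=> x /cone_of_nil.
have scw x : cone_of g x -> cone_of (w :: g) x.
  by move=> gx; apply/cone_of_cons; exists 0, x; rewrite scale0r add0r.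
have wg : cone_of (w :: g) w by apply: cone_of_sub; rewrite inE eqxx.
have [|g0|[u u0 gu]|[u [v [uv guv]]]] := IHg.
- by move=> x gx gNx; apply: scg; apply: scw.
- have [w0|w0] := eqVneq w 0.
    constructor 1; apply/seteqP; split=> x /=.
      by rewrite w0 => /cone_of_cons[c [y [_ + ->]]]; rewrite g0 scaler0 add0r.
    by move=> ->; apply: scw; rewrite g0.
  constructor 2; exists w => //; apply/seteqP; split=> x.
    move=> /cone_of_cons[c [y [c0 + ->]]]; rewrite g0 => ->.
    by apply/cone_of1; exists c; rewrite addr0.
  move=> /cone_of1[c [c0 ->]]; apply/cone_of_cons; exists c, 0.
  by rewrite addr0 g0.
- have ug : cone_of (w :: g) u.
    by apply: scw; rewrite gu; apply: cone_of_sub; rewrite inE.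
  have -> : cone_of (w :: g) = cone_of [:: w; u].
    apply/seteqP; split=> x /cone_of_cons[c [y [c0 yu ->]]];
      by apply/cone_of_cons; exists c, y; rewrite gu in yu *.
  have [wu|wu|wu] := ltgtP (wedge w u : R) 0.
  + constructor 3; exists u, w; rewrite cone_of_swap; split=> //.
    by rewrite wedgeC oppr_gt0.
  + by constructor 3; exists w, u.
  + have [|c wE] := wedge_eq0 u0 (y := w); first by rewrite wedgeC wu oppr0.
    constructor 2; exists u => //; apply/seteqP; split=> x; last first.
      by move=> /cone_of1[b [b0 ->]]; apply/cone_of2; exists 0, b;
        rewrite scale0r add0r.
    (* A negative [c] would put [- u] in the cone together with [u]. *)
    have c0 : 0 <= c.
      rewrite leNgt; apply/negP => c0; suff /eqP : u = 0 by rewrite (negbTE u0).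
      apply: scg => //; apply/cone_of_cons; exists (- c^-1), 0.
      rewrite oppr_ge0 invr_le0 (ltW c0) wE scalerA mulNr mulVf ?lt_eqF //.
      rewrite scaleN1r addr0; split=> //; rewrite gu; apply/cone_of1.
      by exists 0; rewrite scale0r.
    move=> /cone_of2[a [b [a0 b0 ->]]]; apply/cone_of1.
    exists (a * c + b); rewrite wE scalerA -scalerDl; split=> //.
    by rewrite addr_ge0 ?mulr_ge0.
- have ug : cone_of g u by rewrite guv; apply: cone_of_sub; rewrite inE eqxx.
  have vg : cone_of g v by rewrite guv; apply: cone_of_sub; rewrite !inE eqxx orbT.
  have gE a b : 0 <= a -> 0 <= b -> cone_of g (a *: u + b *: v).
    by move=> a0 b0; rewrite guv; apply/cone_of2; exists a, b.
  have E := cramer u v w; rewrite addrC in E.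
  have uvN0 : wedge u v != 0 :> R by rewrite gt_eqF.
  have wE : w = (wedge w v / wedge u v : R) *: u + (wedge u w / wedge u v : R) *: v.
    apply: (scalerI uvN0); rewrite E addrC scalerDr !scalerA.
    by rewrite ![wedge u v * _]mulrC !divfK.
  (* The signs of the two coordinates of [w] tell which of the edges [u], [v] survive. *)
  have [uw|uw] := leP 0 (wedge u w : R); have [wv|wv] := leP 0 (wedge w v : R).
  + constructor 3; exists u, v; split=> //; rewrite -guv.
    apply/seteqP; split=> x; last exact: scw.
    move=> /cone_of_cons[c [y [c0 + ->]]]; rewrite guv.
    move=> /(mem_cone2 _ uv)[uy yv]; apply/(mem_cone2 _ uv).
    by rewrite wedgeD wedgeDl wedgeZ wedgeZl !addr_ge0 ?mulr_ge0.
  + have [uw0|uw0] := eqVneq (wedge u w : R) 0.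
      suff w0 : w = 0 by move: wv; rewrite w0 wedgeC linear0 oppr0 ltxx.
      apply: scg => //; apply: scw; rewrite wE opprD -!scaleNr.
      by apply: gE; rewrite ?uw0 ?mul0r ?oppr0 // -mulNr divr_ge0 ?oppr_ge0 ?ltW.
    have uw1 : 0 < wedge u w :> R by rewrite lt_def uw0.
    constructor 3; exists u, w; split=> //; apply/seteqP; split=> x.
      move=> /cone_of_cons[c [y [c0 + ->]]]; rewrite guv.
      move=> /cone_of2[a [b [a0 b0 ->]]]; apply/(mem_cone2 _ uw1).
      rewrite !wedgeD !wedgeDl !wedgeZ !wedgeZl !wedgexx !mulr0.
      rewrite !add0r; split; rewrite !addr_ge0 ?mulr_ge0 ?(ltW uv) //.
      by rewrite wedgeC oppr_ge0 ltW.
    move=> /cone_of2[a [b [a0 b0 ->]]]; apply/cone_of_cons.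
    exists b, (a *: u); rewrite addrC; split=> //.
    by rewrite -[a *: u]addr0 -(scale0r v); apply: gE.
  + have [wv0|wv0] := eqVneq (wedge w v : R) 0.
      suff w0 : w = 0 by move: uw; rewrite w0 linear0 ltxx.
      apply: scg => //; apply: scw; rewrite wE opprD -!scaleNr.
      by apply: gE; rewrite ?wv0 ?mul0r ?oppr0 // -mulNr divr_ge0 ?oppr_ge0 ?ltW.
    have wv1 : 0 < wedge w v :> R by rewrite lt_def wv0.
    constructor 3; exists w, v; split=> //; apply/seteqP; split=> x.
      move=> /cone_of_cons[c [y [c0 + ->]]]; rewrite guv.
      move=> /cone_of2[a [b [a0 b0 ->]]]; apply/(mem_cone2 _ wv1).
      rewrite !wedgeD !wedgeDl !wedgeZ !wedgeZl !wedgexx !mulr0.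
      rewrite !addr0 ?add0r; split; rewrite !addr_ge0 ?mulr_ge0 ?(ltW uv) //.
      by rewrite wedgeC oppr_ge0 ltW.
    move=> /cone_of2[a [b [a0 b0 ->]]]; apply/cone_of_cons.
    exists a, (b *: v); split=> //.
    by rewrite -[b *: v]add0r -(scale0r u); apply: gE.
  + suff w0 : w = 0 by move: uw; rewrite w0 linear0 ltxx.
    apply: scg => //; apply: scw; rewrite wE opprD -!scaleNr.
    by apply: gE; rewrite -mulNr divr_ge0 ?oppr_ge0 ?ltW.
Qed.

Lemma cone_dim1 u : u != 0 -> cone_dim (cone_of [:: u]) 1.
Proof. by move=> u0; exists [:: u]; rewrite span_seq1 dim_vline u0. Qed.

(** Dimension one excludes the other two shapes: the generators of the zero cone span nothing, and a
    positive basis inside the cone forces dimension two. *)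
Lemma ray_cone_of (L : H -> Prop) s : ray L s ->
  exists2 u, u != 0 & s = cone_of [:: u].
Proof.
move=> [[g [_ ->]] scg [g' [gg' dimg']]].
have [g0|//|[u [v [uv guv]]]] := strongly_convex_cone_of scg.
  suff : (<<g'>> <= 0)%VS by rewrite subv0 => /eqP g'0; rewrite g'0 dimv0 in dimg'.
  apply/span_subvP => x xg'; have := cone_of_sub xg'.
  by rewrite -gg' g0 /= => ->; exact: mem0v.
have : (<<[:: u; v]>> <= <<g'>>)%VS.
  apply/span_subvP => x xuv; apply: cone_of_span; rewrite -gg' guv.
  exact: cone_of_sub.
by move=> /dimvS; rewrite wedge_free ?gt_eqF // dimg'.
Qed.

Lemma cone_face_line u v : 0 < wedge u v :> R ->
  cone_face (cone_of [:: u]) (cone_of [:: u; v]).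
Proof.
move=> uv; exists (wedge u); split=> [x /(mem_cone2 _ uv)[]//|].
apply/seteqP; split=> x /=.
  move=> /cone_of1[c [c0 ->]]; rewrite wedgeZ wedgexx mulr0; split=> //.
  by apply/cone_of2; exists c, 0; rewrite scale0r addr0.
move=> [/cone_of2[b [c [b0 c0 ->]]]]; rewrite wedgeD !wedgeZ wedgexx mulr0 add0r.
move=> /eqP; rewrite mulf_eq0 (gt_eqF uv) orbF => /eqP->.
by apply/cone_of1; exists b; rewrite scale0r addr0.
Qed.

Lemma cone_face_line_r u v : 0 < wedge u v :> R ->
  cone_face (cone_of [:: v]) (cone_of [:: u; v]).
Proof.
move=> uv; exists (- wedge v); split=> [x /(mem_cone2 _ uv)[_]|].
  by rewrite wedgeC opp_lfunE.
apply/seteqP; split=> x /=; rewrite opp_lfunE.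
  move=> /cone_of1[c [c0 ->]]; rewrite wedgeZ wedgexx mulr0 oppr0; split=> //.
  by apply/cone_of2; exists 0, c; rewrite scale0r add0r.
move=> [/cone_of2[b [c [b0 c0 ->]]]]; rewrite -wedgeC wedgeDl !wedgeZl wedgexx.
rewrite mulr0 addr0 => /eqP; rewrite mulf_eq0 (gt_eqF uv) orbF => /eqP->.
by apply/cone_of1; exists c; rewrite scale0r add0r.
Qed.

End PlanarCones.

(** * Fans generated by cyclically ordered classes *)

(** Up to a common positive factor, [(v1, v2)] and [(w1, w2)] are the coordinates of [v], [w] in a
    positive basis [e], [f]. The hypotheses say that neither [v] nor [w] is strictly between [e] and
    [f], that neither [e] nor [f] is strictly between [v] and [w], and that [e + f] is in the cone
    on the positive pair [v], [w]. Then [v] is on the ray of [e] and [w] on that of [f]. *)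
Lemma cone_coordinates (R : realFieldType) (v1 v2 w1 w2 : R) :
  (0 < v2 -> 0 < v1 -> False) -> (0 < w2 -> 0 < w1 -> False) ->
  (0 < - v2 -> 0 < w2 -> False) -> (0 < v1 -> 0 < - w1 -> False) ->
  0 <= - v2 + v1 -> 0 <= w2 - w1 -> 0 < v1 * w2 - w1 * v2 ->
  [/\ v2 = 0, w1 = 0, 0 < v1 & 0 < w2].
Proof.
move=> nv nw ne nf vx xw vw.
have v2le : v2 <= 0 by rewrite leNgt; apply/negP => v2p; apply: nv => //; lra.
have w1le : w1 <= 0 by rewrite leNgt; apply/negP => w1p; apply: nw => //; lra.
have v20 : v2 = 0.
  apply/eqP; rewrite eq_le v2le /= leNgt; apply/negP => v2n.
  have w2le : w2 <= 0 by rewrite leNgt; apply/negP => w2p; apply: ne => //; lra.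
  have [v1p|v1n] := ltP 0 v1.
    have v1w2 : v1 * w2 <= 0 by rewrite pmulr_rle0.
    have w1v2 : 0 <= w1 * v2 by rewrite mulr_le0 // ltW.
    by lra.
  (* These two products add up to the determinant, which is positive. *)
  have P1 : v1 * (w2 - w1) <= 0 by rewrite mulr_le0_ge0.
  have P2 : w1 * (v1 - v2) <= 0 by rewrite mulr_le0_ge0 //; lra.
  by lra.
rewrite v20 mulr0 subr0 in vw; rewrite v20 oppr0 add0r in vx.
have v1p : 0 < v1.
  by rewrite lt_def vx andbT; apply/eqP => v10; rewrite v10 mul0r ltxx in vw.
have w2p : 0 < w2 by rewrite pmulr_rgt0 in vw.
split=> //; apply/eqP; rewrite eq_le w1le /= leNgt; apply/negP => w1n.
by apply: nf => //; lra.
Qed.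

Section FanOfFlows.
Variables (R : realType) (H : vectType R) (J0 J1 : 'Hom(H, R^o)).
Hypothesis J_inj : forall x, J0 x = 0 -> J1 x = 0 -> x = 0.
Local Notation D := (wedge J0 J1).

(* The corners of a face, in cyclic order under [nx], with the class [u a] and
   the direction [th a] of the flow passing through the corner [a]. *)
Variables (I : Type) (P : I -> Prop) (u : I -> H) (th : I -> plane R).
Variables nx pv : I -> I.
Hypothesis P_nx : forall a, P a -> P (nx a).
Hypothesis P_pv : forall a, P a -> P (pv a).
Hypothesis pvK : cancel pv nx.
Hypothesis u_nx : forall a, P a -> 0 < D (u a) (u (nx a)) :> R.
Hypothesis det_th : forall a a', P a -> P a' ->
  0 < D (u a) (u a') :> R -> 0 < det2 (th a) (th a').
Hypothesis th_corner : forall a a', P a -> P a' ->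
  0 <= det2 (th a) (th a') -> 0 <= det2 (th a') (th (nx a)) ->
  a' = a \/ a' = nx a.

Lemma det2C (x y : plane R) : det2 x y = - det2 y x.
Proof. by rewrite /det2 opprB mulrC [X in _ - X]mulrC. Qed.

(* When [u a'] is a multiple of an end, say [u a], replacing [a] by its
   predecessor makes all the inequalities strict again. *)
Lemma no_flow_between a a' : P a -> P a' ->
  0 <= D (u a) (u a') :> R -> 0 <= D (u a') (u (nx a)) :> R ->
  a' = a \/ a' = nx a.
Proof.
move=> Pa Pa' aa' a'n; have an := u_nx Pa.
have Pn := P_nx Pa.
have E := cramer J_inj (u a) (u (nx a)) (u a').
have [aa'0|aa'0] := eqVneq (D (u a) (u a') : R) 0.
  have a'n0 : 0 < D (u a') (u (nx a)) :> R.
    rewrite lt_def a'n andbT; apply/eqP => a'n0.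
    move: E; rewrite aa'0 a'n0 !scale0r addr0 => /eqP.
    rewrite scaler_eq0 gt_eqF //= => /eqP ua'.
    by have := u_nx Pa'; rewrite ua' wedgeC linear0 oppr0 ltxx.
  have Pp := P_pv Pa.
  have pa : 0 < D (u (pv a)) (u a) :> R by have := u_nx Pp; rewrite pvK.
  have pa' : 0 < D (u (pv a)) (u a') :> R.
    rewrite -(pmulr_rgt0 _ an) -wedgeZ E aa'0 scale0r addr0 wedgeZ.
    exact: mulr_gt0.
  have := det_th Pp Pa' pa'; have := det_th Pa' Pn a'n0.
  move=> /ltW dn /ltW dp.
  have [d|d] := leP 0 (det2 (th a) (th a')); first exact: th_corner.
  have d' : 0 <= det2 (th a') (th a) by rewrite det2C oppr_ge0 ltW.
  have [|a'p|a'p] := @th_corner (pv a) a' Pp Pa' dp; first by rewrite pvK.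
    by move: pa'; rewrite a'p wedgexx ltxx.
  by left; rewrite a'p pvK.
have aa'1 : 0 < D (u a) (u a') :> R by rewrite lt_def aa'0.
have daa' := det_th Pa Pa' aa'1.
have [a'n0|a'n0] := eqVneq (D (u a') (u (nx a)) : R) 0; last first.
  have a'n1 : 0 < D (u a') (u (nx a)) :> R by rewrite lt_def a'n0.
  by have da'n := det_th Pa' Pn a'n1; apply: th_corner; rewrite // ltW.
have Pnn := P_nx Pn; have nn := u_nx Pn.
have a'nn : 0 < D (u a') (u (nx (nx a))) :> R.
  rewrite -(pmulr_rgt0 _ an) -wedgeZl E a'n0 scale0r add0r wedgeZl.
  exact: mulr_gt0.
have /ltW dn := det_th Pa' Pnn a'nn.
have [d|d] := leP 0 (det2 (th a') (th (nx a))).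
  by apply: th_corner => //; exact: ltW.
have d' : 0 <= det2 (th (nx a)) (th a') by rewrite det2C oppr_ge0 ltW.
have [|a'p] := th_corner Pn Pa' d' dn; first by right.
by move: a'nn; rewrite a'p wedgexx ltxx.
Qed.

Variables (L : H -> Prop) (S : set (set H)).
Hypothesis fanS : fan L S.
Hypothesis completeS : complete S.
Hypothesis raysS : forall s, (S s /\ cone_dim s 1) <->
  exists a, P a /\ s = cone_of [:: u a].

Lemma flow_neq0 a : P a -> u a != 0.
Proof.
move=> Pa; apply/eqP => ua0; have := u_nx Pa.
by rewrite ua0 wedgeC linear0 oppr0 ltxx.
Qed.

Lemma flow_ray a : P a -> S (cone_of [:: u a]).
Proof. by move=> Pa; case: (raysS (cone_of [:: u a])) => _ []//; exists a. Qed.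

Lemma line_flow v : v != 0 -> S (cone_of [:: v]) ->
  exists a, exists c, [/\ P a, 0 < c, v = c *: u a & cone_of [:: v] = cone_of [:: u a]].
Proof.
move=> v0 Sv; have [|a [Pa va]] := (raysS (cone_of [:: v])).1.
  by split=> //; exact: cone_dim1.
have : cone_of [:: v] v by apply: cone_of_sub; rewrite inE.
rewrite va => /cone_of1[c [c0 vE]]; exists a, c; split=> //.
by rewrite lt_def c0 andbT; apply: contra_neq v0 => c00; rewrite vE c00 scale0r.
Qed.

(** The ray of [z] meets the cone in a face, cut out by some [m] vanishing at [z]. As [z] is a
    positive combination of [v] and [w], also [m v = 0], so that [v] would lie on the ray of [z]. *)
Lemma no_ray_inside v w z : 0 < D v w :> R -> S (cone_of [:: v; w]) ->
  S (cone_of [:: z]) -> 0 < D v z :> R -> 0 < D z w :> R -> False.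
Proof.
move=> vw Svw Sz vz zw.
have [_ _ _ /(_ _ _ Svw Sz)[[m [m0 mE]] _]] := fanS.
have mem y : cone_of [:: v; w] y -> m y = 0 -> cone_of [:: z] y.
  by move=> yvw my; suff [] : (cone_of [:: v; w] `&` cone_of [:: z]) y; rewrite ?mE.
have mz : m z = 0.
  suff : (cone_of [:: v; w] `&` cone_of [:: z]) z by rewrite mE => -[].
  split; last by apply: cone_of_sub; rewrite inE.
  by apply/(mem_cone2 J_inj z vw); rewrite !ltW.
have vvw : cone_of [:: v; w] v by apply: cone_of_sub; rewrite !inE eqxx.
have wvw : cone_of [:: v; w] w by apply: cone_of_sub; rewrite !inE eqxx orbT.
have mv : m v = 0.
  have : m ((D v w : R) *: z) = 0 by rewrite linearZ /= mz scaler0.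
  rewrite (cramer J_inj) linearD !linearZ /= => /eqP.
  rewrite paddr_eq0 ?mulr_ge0 ?(ltW vz) ?(ltW zw) ?m0 // => /andP[+ _].
  by rewrite mulf_eq0 (gt_eqF zw) => /eqP.
have /cone_of1[c [_ vE]] := mem v vvw mv.
by move: vz; rewrite vE wedgeZl wedgexx mulr0 ltxx.
Qed.

Lemma between_flows_false a v : P a -> v != 0 -> S (cone_of [:: v]) ->
  0 < D (u a) v :> R -> 0 < D v (u (nx a)) :> R -> False.
Proof.
move=> Pa v0 Sv; have [a' [c [Pa' c0 -> _]]] := line_flow v0 Sv.
rewrite wedgeZ wedgeZl !pmulr_rgt0 // => aa' a'n.
have [] := no_flow_between Pa Pa' (ltW aa') (ltW a'n) => a'E.
  by move: aa'; rewrite a'E wedgexx ltxx.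
by move: a'n; rewrite a'E wedgexx ltxx.
Qed.

(** A cone of the fan containing [e + f] must be two dimensional, since no ray of the fan lies
    strictly between [e] and [f]. Its edges are rays of the fan, so they avoid the interior of the
    cone on [e], [f], and conversely [e], [f] avoid its own interior. Hence the two cones agree. *)
Lemma consecutive_flows_span a : P a -> S (cone_of [:: u a; u (nx a)]).
Proof.
move=> Pa; have Pn := P_nx Pa; have ef := u_nx Pa.
set e := u a in ef *; set f := u (nx a) in ef *.
have [s [Ss sx]] := completeS (e + f).
have [_ /(_ _ Ss)[[g [_ sg]] scs] Sface _] := fanS.
have ex : 0 < D e (e + f) :> R by rewrite wedgeD wedgexx add0r.
have xf : 0 < D (e + f) f :> R by rewrite wedgeDl wedgexx addr0.
rewrite sg in scs sx Ss.
have [g0|[v v0 gv]|[v [w [vw gvw]]]] := strongly_convex_cone_of J_inj scs.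
- by move: sx; rewrite g0 /= => x0; move: ex; rewrite x0 linear0 ltxx.
- rewrite gv in sx Ss; move: sx => /cone_of1[c [c0 xE]].
  have c1 : 0 < c.
    rewrite lt_def c0 andbT; apply/eqP => c00.
    by move: ex; rewrite xE c00 scale0r linear0 ltxx.
  rewrite xE wedgeZ pmulr_rgt0 // in ex.
  rewrite xE wedgeZl pmulr_rgt0 // in xf.
  by case: (@between_flows_false a v).
rewrite gvw in sx Ss; have [vx xw] := (mem_cone2 J_inj _ vw).1 sx.
have v0 : v != 0 by apply/eqP => v0; move: vw; rewrite v0 wedgeC linear0 oppr0 ltxx.
have w0 : w != 0 by apply/eqP => w0; move: vw; rewrite w0 linear0 ltxx.
have Sv : S (cone_of [:: v]) by apply: Sface Ss _; exact: (cone_face_line J_inj).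
have Sw : S (cone_of [:: w]) by apply: Sface Ss _; exact: (cone_face_line_r J_inj).
have nv := @between_flows_false a v Pa v0 Sv.
have nw := @between_flows_false a w Pa w0 Sw.
have ne := no_ray_inside vw Ss (flow_ray Pa).
have nf := no_ray_inside vw Ss (flow_ray Pn).
rewrite -/e -/f in nv nw ne nf.
have vE := cramer J_inj e f v; have wE := cramer J_inj e f w.
(* The wedge of [v], [w] as a determinant of their coordinates with respect to [e], [f]. *)
have vwE : (D e f : R) * D v w = D v f * D e w - D w f * D e v :> R.
  rewrite -wedgeZ wE wedgeD !wedgeZ [D v e]wedgeC; ring.
have {}vw : 0 < (D e f : R) * D v w by exact: mulr_gt0.
rewrite vwE in vw; rewrite wedgeD [D v e]wedgeC in vx.
rewrite wedgeDl [D f w]wedgeC in xw; rewrite [D v e]wedgeC in ne.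
rewrite [D f w]wedgeC in nf.
set v1 : R := D v f in vE nv nf vw vx; set v2 : R := D e v in vE nv ne vw vx.
set w1 : R := D w f in wE nw nf vw xw; set w2 : R := D e w in wE nw ne vw xw.
have [v20 w10 v1p w2p] := cone_coordinates nv nw ne nf vx xw vw.
rewrite v20 scale0r addr0 in vE; rewrite w10 scale0r add0r in wE.
have -> : cone_of [:: e; f] = cone_of [:: v; w]; last exact: Ss.
rewrite -!cone_of_add -(cone_of1_scale e v1p) -vE -(cone_of1_scale f w2p) -wE.
by rewrite !cone_of1_scale.
Qed.

(** If [u a'] came strictly before [u (nx a)] it would be a flow in between; if strictly after,
    [u (nx a)] would be a ray inside a cone of the fan. So they are parallel, and on the same side
    of [u a]. *)
Lemma spanning_flow_is_next a a' : P a -> P a' ->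
  S (cone_of [:: u a; u a']) -> 0 < D (u a) (u a') :> R ->
  cone_of [:: u a'] = cone_of [:: u (nx a)].
Proof.
move=> Pa Pa' Saa' aa'; have Pn := P_nx Pa; have an := u_nx Pa.
have [na'|na'|na'] := ltgtP (D (u (nx a)) (u a') : R) 0.
- have a'n : 0 <= D (u a') (u (nx a)) :> R by rewrite wedgeC oppr_ge0 ltW.
  have [a'E|->//] := no_flow_between Pa Pa' (ltW aa') a'n.
  by move: aa'; rewrite a'E wedgexx ltxx.
- by case: (no_ray_inside aa' Saa' (flow_ray Pn) an na').
have [c a'E] := wedge_eq0 J_inj (flow_neq0 Pn) na'.
move: aa'; rewrite a'E wedgeZ pmulr_lgt0 // => c0.
exact: cone_of1_scale.
Qed.

Lemma consecutive_flows_span_2dim a : P a ->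
  span_2dim_cone S (cone_of [:: u a]) (cone_of [:: u (nx a)]) /\
  span_2dim_cone S (cone_of [:: u (nx a)]) (cone_of [:: u a]).
Proof.
move=> Pa; have San := consecutive_flows_span Pa; have an := u_nx Pa.
rewrite /span_2dim_cone !cone_of_add [cone_of [:: u (nx a); _]]cone_of_swap.
suff dim2 : cone_dim (cone_of [:: u a; u (nx a)]) 2 by [].
by exists [:: u a; u (nx a)]; rewrite (wedge_free (J0 := J0) (J1 := J1)) ?gt_eqF.
Qed.

Lemma span_2dim_consecutive_flows s t : ray L s -> ray L t ->
  span_2dim_cone S s t ->
  exists a, P a /\ ((s = cone_of [:: u a] /\ t = cone_of [:: u (nx a)]) \/
                    (s = cone_of [:: u (nx a)] /\ t = cone_of [:: u a])).
Proof.
move=> /(ray_cone_of J_inj)[v v0 ->] /(ray_cone_of J_inj)[w w0 ->] [].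
rewrite !cone_of_add => Svw [g [gE dimg]].
(* The statement is symmetric in the two rays, and parallel generators would span a line only. *)
wlog vw : v w v0 w0 Svw gE / 0 < D v w :> R => [wlg|].
  have [vw|vw|vw] := ltgtP (D v w : R) 0; last 1 first.
  - have [c wE] := wedge_eq0 J_inj v0 vw.
    have : (<<g>> <= <[v]>)%VS.
      apply/span_subvP => x xg; have := cone_of_sub xg.
      rewrite -gE => /cone_of2[b [b' [_ _ ->]]].
      by rewrite wE memvD ?memvZ ?memv_line.
    by move=> /dimvS; rewrite dimg dim_vline v0.
  - have [|||a [Pa [[vE wE]|[vE wE]]]] := wlg w v w0 v0.
    + by rewrite cone_of_swap.
    + by rewrite cone_of_swap.
    + by rewrite wedgeC oppr_gt0.
    + by exists a; split=> //; right.
    + by exists a; split=> //; left.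
  - exact: wlg.
have [_ _ Sface _] := fanS.
have Sv : S (cone_of [:: v]) by apply: Sface Svw _; exact: (cone_face_line J_inj).
have Sw : S (cone_of [:: w]) by apply: Sface Svw _; exact: (cone_face_line_r J_inj).
have [a [c [Pa c0 vE Cv]]] := line_flow v0 Sv.
have [b [d [Pb d0 wE Cw]]] := line_flow w0 Sw.
exists a; split=> //; left; split=> //; rewrite Cw.
apply: spanning_flow_is_next => //.
  by rewrite -cone_of_add -Cv -Cw cone_of_add.
by move: vw; rewrite vE wE wedgeZ wedgeZl !pmulr_rgt0.
Qed.

End FanOfFlows.

(** * Homology of the quiver *)

Section ConnectedQuiver.
Variables (V A B W : Type) (Q : surface_quiver V A B W).

Lemma bface_nextB a : bface Q (nextB Q a) = bface Q a.
Proof. by apply/esym/bface_orbit; exists 1%N. Qed.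

Lemma wface_nextW a : wface Q (nextW Q a) = wface Q a.
Proof. by apply/esym/wface_orbit; exists 1%N. Qed.

Lemma bface_prevB a : bface Q (prevB Q a) = bface Q a.
Proof. by rewrite -bface_nextB prevBK. Qed.

Lemma wface_prevW a : wface Q (prevW Q a) = wface Q a.
Proof. by rewrite -wface_nextW prevWK. Qed.

Lemma hd_prevB a : hd Q (prevB Q a) = tl Q a.
Proof. by rewrite -tl_nextB prevBK. Qed.

Lemma hd_prevW a : hd Q (prevW Q a) = tl Q a.
Proof. by rewrite -tl_nextW prevWK. Qed.

(** The arrows into a vertex are linked by [prevW \o nextB], so [P] holds for all or none of them.
    It then spreads along a walk, because [prevB] turns an arrow out of a vertex into an arrow
    entering it. *)
Lemma connected_arrows (P : A -> Prop) : connected_quiver Q ->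
  (forall a, P a <-> P (nextB Q a)) -> (forall a, P a <-> P (nextW Q a)) ->
  forall a a', P a -> P a'.
Proof.
move=> conQ PB PW a a' Pa.
have Phd b b' : hd Q b = hd Q b' -> P b -> P b'.
  move=> /hd_orbit[n ->] Pb; elim: n => //= n IHn.
  by apply: (PW _).2; rewrite prevWK; apply: (PB _).1.
have Pwalk s x y : walk Q x s y -> (forall b, hd Q b = x -> P b) ->
    forall b, hd Q b = y -> P b.
  elim: s x => [|[c d] s IHs] x /=; first by move=> ->.
  move=> [<- /IHs IH] Px; apply: IH => b; case: d Px.
    move=> /(_ (prevB Q c)); rewrite hd_prevB => /(_ erefl)/(PB _).1.
    by rewrite prevBK => Pc /esym/Phd; apply.
  move=> /(_ c erefl) Pc.
  by rewrite /dart_tgt /= -hd_prevB => /esym/Phd; apply; apply: (PB _).2; rewrite prevBK.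
have [s] := conQ (hd Q a) (hd Q a').
by move=> /Pwalk; apply=> // b /esym/Phd; apply.
Qed.

End ConnectedQuiver.

(** * The dimension of the first homology *)

Section Dimensions.
Variables (R : realType) (V A B W : finType) (Q : surface_quiver V A B W).
Hypothesis conQ : connected_quiver Q.
Local Notation chains T := {ffun T -> R^o}.

Lemma dim_chains (T : finType) : \dim {: chains T} = #|T|.
Proof. by rewrite dimvf /dim /= muln1. Qed.

(** The cellular boundary of two-chains, read as the jump of a function on faces across each arrow;
    the sign reflects that white faces are traversed clockwise. *)
Definition boundary2 (g : chains (B + W)%type) : chains A :=
  [ffun a => g (inl (bface Q a)) - g (inr (wface Q a))].

Fact boundary2_is_linear : linear boundary2.
Proof.
by move=> k c d; apply/ffunP => a; rewrite !ffunE scalerBr opprD addrACA.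
Qed.

HB.instance Definition _ :=
  GRing.isLinear.Build R (chains (B + W)%type) (chains A) _ boundary2
    boundary2_is_linear.

Lemma face_chainE f a :
  face_chain R Q f a = (inl (bface Q a) == f)%:R - (inr (wface Q a) == f)%:R.
Proof.
case: f => [b|w] /=; rewrite ?ffunE sum_ffunE.
  rewrite subr0 (eq_bigr (fun e => (e == a)%:R)); last first.
    by move=> e _; rewrite ffunE eq_sym.
  rewrite (big_mkcond (fun e => bface Q e == b)) (bigD1 a) //= eqxx.
  rewrite big1 ?addr0; first by case: eqP => [->|]; rewrite ?eqxx //; case: eqP => // -[].
  by move=> e /negbTE->; case: ifP.
rewrite sub0r; congr (- _).
rewrite (eq_bigr (fun e => (e == a)%:R)); last first.
  by move=> e _; rewrite ffunE eq_sym.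
rewrite (big_mkcond (fun e => wface Q e == w)) (bigD1 a) //= eqxx.
rewrite big1 ?addr0; first by case: eqP => [->|]; rewrite ?eqxx //; case: eqP => // -[].
by move=> e /negbTE->; case: ifP.
Qed.

Lemma boundariesE : boundaries R Q = limg (linfun boundary2).
Proof.
apply/eqP; rewrite eqEsubv; apply/andP; split.
  apply/span_subvP => _ /fintype.imageP[f _ ->].
  have -> : face_chain R Q f = linfun boundary2 [ffun f' => (f' == f)%:R].
    by apply/ffunP => a; rewrite lfunE /= face_chainE !ffunE.
  exact: memv_img (memvf _).
apply/subvP => _ /memv_imgP[g _ ->]; rewrite lfunE /=.
have -> : boundary2 g = \sum_f (g f : R) *: face_chain R Q f.
  apply/ffunP => a; rewrite sum_ffunE !ffunE.
  under eq_bigr do rewrite ffunE face_chainE scalerBr.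
  rewrite sumrB; congr (_ - _).
    rewrite (bigD1 (inl (bface Q a))) //= eqxx big1 ?addr0 => [|f /negbTE fE].
      by rewrite /GRing.scale /= mulr1.
    by rewrite eq_sym fE scaler0.
  rewrite (bigD1 (inr (wface Q a))) //= eqxx big1 ?addr0 => [|f /negbTE fE].
    by rewrite /GRing.scale /= mulr1.
  by rewrite eq_sym fE scaler0.
by apply: memv_suml => f _; apply: memvZ; apply: memv_span; apply: fintype.image_f.
Qed.

Lemma memv_boundaries z : z \in boundaries R Q <->
  exists g : chains (B + W)%type,
    forall a, z a = g (inl (bface Q a)) - g (inr (wface Q a)).
Proof.
rewrite boundariesE; split=> [/memv_imgP[g _ ->]|[g zE]].
  by exists g => a; rewrite lfunE /= ffunE.
apply/memv_imgP; exists g; rewrite ?memvf // lfunE /=.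
by apply/ffunP => a; rewrite ffunE.
Qed.

Lemma face_function_const (g : B + W -> R) :
  (forall a, g (inl (bface Q a)) = g (inr (wface Q a))) ->
  forall f f', g f = g f'.
Proof.
move=> gBW.
have gc a a' : g (inl (bface Q a)) = g (inl (bface Q a')).
  pose P e := g (inl (bface Q a)) = g (inl (bface Q e)).
  apply: (@connected_arrows _ _ _ _ Q P conQ _ _ a) => // e; rewrite /P.
    by rewrite bface_nextB.
  by rewrite [g (inl (bface Q e))]gBW [g (inl (bface Q (nextW Q e)))]gBW wface_nextW.
have gA f : exists a, g f = g (inl (bface Q a)).
  case: f => [b|w]; first by have [a <-] := bface_surj Q b; exists a.
  by have [a <-] := wface_surj Q w; exists a.
by move=> f f'; have [a ->] := gA f; have [a' ->] := gA f'.
Qed.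

(** By connectedness the kernel of [boundary2] contains only constant functions; the bound follows
    by rank and nullity. *)
Lemma dim_boundaries : (#|{: B + W}| <= \dim (boundaries R Q) + 1)%N.
Proof.
rewrite boundariesE -dim_chains -(limg_ker_dim (linfun boundary2) fullv).
rewrite addnC leq_add2l capfv.
suff : (lker (linfun boundary2) <= <[[ffun=> 1] : chains (B + W)%type]>)%VS.
  by move=> /dimvS/leq_trans; apply; rewrite dim_vline leq_b1.
apply/subvP => g; rewrite memv_ker lfunE /= => /eqP/ffunP gE.
have gc : forall f f', g f = g f'.
  apply: face_function_const => a; apply/eqP; rewrite -subr_eq0; apply/eqP.
  by have := gE a; rewrite !ffunE.
case: (pickP (predT : pred (B + W)%type)) => [f _|empty].
  apply/vlineP; exists (g f : R); apply/ffunP => f'.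
  by rewrite !ffunE (gc f' f) /GRing.scale /= mulr1.
have -> : g = 0 by apply/ffunP => f; have := empty f.
exact: mem0v.
Qed.

Lemma boundary1_arrow a : boundary1 Q (arrow_chain R a) =
  [ffun v => (v == hd Q a)%:R - (v == tl Q a)%:R].
Proof.
apply/ffunP => v; rewrite !ffunE; congr (_ - _);
  rewrite big_mkcond (bigD1 a) //= ffunE eqxx [LHS]addrC big1 ?add0r 1?eq_sym;
  by [case: eqP | move=> e /negbTE ea; rewrite ffunE ea; case: ifP].
Qed.

(** Along a walk from [v0], boundaries of arrows carry the chain of one vertex to that of the next.
    So the image of [boundary1] together with [d v0] is everything, and the rank is at least
    [#|V| - 1]. *)
Lemma dim_cycles : (\dim (cycles R Q) + #|V| <= #|A| + 1)%N.
Proof.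
rewrite -[X in (_ <= X + _)%N]dim_chains.
rewrite -(limg_ker_dim (linfun (boundary1 (R := R) Q)) fullv) capfv -addnA leq_add2l.
case: (pickP (predT : pred V)) => [v0 _|empty]; last by rewrite eq_card0.
pose d v : chains V := [ffun v' => (v' == v)%:R].
rewrite -dim_chains; suff /dimvS/leq_trans : ({:chains V} <=
    limg (linfun (boundary1 (R := R) Q)) + <[d v0]>)%VS.
  apply; apply: leq_trans (dimv_add_leqif _ _).1 _.
  by rewrite leq_add2l dim_vline leq_b1.
set U := (_ + _)%VS.
have dU v : d v \in U.
  have [s wQ] := conQ v0 v.
  have dv0 : d v0 \in U by rewrite -[d v0]add0r memv_add ?mem0v ?memv_line.
  suff walkU x : d x \in U -> walk Q x s v -> d v \in U by exact: walkU dv0 wQ.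
  elim: s {wQ} x => [|[a b] s IHs] x /= dx; first by move=> <-.
  move=> [xE]; apply: IHs.
  have daU : boundary1 Q (arrow_chain R a) \in U.
    rewrite -[boundary1 _ _]addr0 memv_add ?mem0v //.
    by rewrite -[boundary1 _ _](lfunE (boundary1 (R := R) Q)) memv_img ?memvf.
  have dE : boundary1 Q (arrow_chain R a) = d (hd Q a) - d (tl Q a).
    by rewrite boundary1_arrow; apply/ffunP => w; rewrite !ffunE.
  rewrite -xE /dart_src /dart_tgt /= in dx *; case: b dx {xE} => dx.
    by rewrite -[d _](subrK (d (tl Q a))) -dE memvD.
  by rewrite -[d (tl Q a)](subKr (d (hd Q a))) -dE memvB.
apply/subvP => g _; have -> : g = \sum_v (g v : R) *: d v.
  apply/ffunP => v; rewrite sum_ffunE (bigD1 v) //= big1 ?addr0.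
    by rewrite !ffunE eqxx /GRing.scale /= mulr1.
  by move=> w wv; rewrite !ffunE eq_sym (negbTE wv) scaler0.
by apply: memv_suml => v _; apply: memvZ.
Qed.

(** At each vertex [nextB] matches incoming with outgoing arrows of the same black face, and [nextW]
    does so for the white faces. *)
Lemma boundaries_sub_cycles : (boundaries R Q <= cycles R Q)%VS.
Proof.
apply/subvP => z /memv_boundaries[g zE]; rewrite memv_ker lfunE /=.
apply/eqP/ffunP => v; rewrite !ffunE; apply/eqP; rewrite subr_eq0; apply/eqP.
under eq_bigr do rewrite zE; under [RHS]eq_bigr do rewrite zE.
rewrite !sumrB; congr (_ - _).
  rewrite [RHS](reindex_inj (can_inj (nextBK Q))) /=.
  by apply: eq_big => a; rewrite ?tl_nextB ?bface_nextB.
rewrite [RHS](reindex_inj (can_inj (nextWK Q))) /=.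
by apply: eq_big => a; rewrite ?tl_nextW ?wface_nextW.
Qed.

Fact homology_class_is_linear : linear (@homology_class R V A B W Q).
Proof. by move=> k c d; rewrite /homology_class !linearP. Qed.

HB.instance Definition _ :=
  GRing.isLinear.Build R (chains A) (homology1 R Q) _ (@homology_class R V A B W Q)
    homology_class_is_linear.

Lemma homology_class_eq0 z : z \in cycles R Q ->
  homology_class Q z = 0 <-> z \in boundaries R Q.
Proof.
move=> zc; have -> : (homology_class Q z = 0) <-> (homology_class Q z == vquot_pi _ 0).
  by rewrite linear0; split=> [->|/eqP].
by rewrite vquot_pi_eq subr0 -memv_preim lfunE /= vsprojK.
Qed.

Lemma homology_class_repr (x : homology1 R Q) :
  vsval (repr x) \in cycles R Q /\ homology_class Q (vsval (repr x)) = x.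
Proof. by split; [exact: subvsP | rewrite /homology_class vsvalK vquot_reprK]. Qed.

(** Cycles have dimension at most [#|A| + 1 - #|V|], boundaries at least the number of faces minus
    one; Euler characteristic zero makes the difference at most two. *)
Lemma dim_homology1 : (#|V| + #|{: B + W}| = #|A|)%N ->
  (\dim {: homology1 R Q} <= 2)%N.
Proof.
move=> euler.
have := limg_ker_dim (linfun (@homology_class R V A B W Q)) (cycles R Q).
set K := (_ :&: _)%VS; set I := (_ @: _)%VS => dimKI.
have -> : {: homology1 R Q}%VS = I.
  apply/esym/eqP; rewrite eqEsubv subvf /=; apply/subvP => x _.
  have [zc zE] := homology_class_repr x; apply/memv_imgP.
  by exists (vsval (repr x)); rewrite ?lfunE /= ?zE.
have : (boundaries R Q <= K)%VS.
  apply/subvP => z zb; have zc := subvP boundaries_sub_cycles z zb.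
  by rewrite memv_cap zc memv_ker lfunE; apply/eqP/homology_class_eq0.
move=> /dimvS; move: dim_boundaries dim_cycles dimKI euler.
move: (\dim I) (\dim K) (\dim _) (\dim _) => i k b c; lia.
Qed.

End Dimensions.

(** * Intersection numbers of zig-zag flows *)

(* A flow is encoded by one of its even arrows: [zigzag] moves two steps ahead. *)
Definition zigzag (V A B W : Type) (Q : surface_quiver V A B W) (a : A) : A :=
  nextW Q (nextB Q a).

Lemma zigzag_inj (V A B W : Type) (Q : surface_quiver V A B W) : injective (zigzag Q).
Proof. exact: inj_comp (can_inj (nextWK Q)) (can_inj (nextBK Q)). Qed.

Section ZigzagClasses.
Variables (R : realType) (V A B W : finType) (Q : surface_quiver V A B W).
Local Notation chains T := {ffun T -> R^o}.
Local Notation zigzag := (zigzag Q).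

Lemma fconnect_zigzag c e : fconnect zigzag c (zigzag e) = fconnect zigzag c e.
Proof. by rewrite -(same_fconnect1_r (zigzag_inj (Q := Q))). Qed.

(** The first term marks the even arrows of the flow of [c], the second its odd arrows, which are
    the [nextB] of even ones. *)
Definition zigzag_chain (c : A) : chains A :=
  [ffun e => (fconnect zigzag c e)%:R + (fconnect zigzag c (prevB Q e))%:R].

Lemma zigzag_chain_cycle c : zigzag_chain c \in cycles R Q.
Proof.
rewrite memv_ker lfunE /=; apply/eqP/ffunP => v; rewrite !ffunE.
apply/eqP; rewrite subr_eq0; apply/eqP.
under eq_bigr do rewrite ffunE; under [RHS]eq_bigr do rewrite ffunE.
rewrite !big_split /= addrC; congr (_ + _).
  rewrite [RHS](reindex_inj (can_inj (nextWK Q))) /=.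
  apply: eq_big => a; rewrite ?tl_nextW // => _.
  by rewrite -[X in fconnect _ _ (nextW Q X)](prevBK Q) fconnect_zigzag.
rewrite [RHS](reindex_inj (can_inj (nextBK Q))) /=.
by apply: eq_big => a; rewrite ?tl_nextB ?nextBK.
Qed.

Definition zigzag_class (c : A) : homology1 R Q := homology_class Q (zigzag_chain c).

Lemma zigzag_class_eq c d : fconnect zigzag c d -> zigzag_class c = zigzag_class d.
Proof.
move=> cd; congr (homology_class Q); apply/ffunP => e; rewrite !ffunE.
by rewrite !(same_connect (fconnect_sym (zigzag_inj (Q := Q))) cd).
Qed.

(* The intersection number with the flow of [c], as a functional on chains. *)
Definition flux (c : A) (z : chains A) : R^o :=
  \sum_(e | fconnect zigzag c e) (z (nextB Q e) - z e).

Fact flux_is_linear c : linear (flux c).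
Proof.
move=> k x y; rewrite /flux scaler_sumr -big_split; apply: eq_bigr => e _ /=.
by rewrite !ffunE scalerBr opprD addrACA.
Qed.

HB.instance Definition _ c :=
  GRing.isLinear.Build R (chains A) R^o _ (flux c) (flux_is_linear c).

(** For the boundary of [g] the terms at the common black face of [e] and [nextB e] cancel, and the
    values at the white faces telescope around the orbit. *)
Lemma flux_boundary c z : z \in boundaries R Q -> flux c z = 0.
Proof.
move=> /memv_boundaries[g zE]; rewrite /flux.
transitivity (\sum_(e | fconnect zigzag c e)
    (g (inr (wface Q e)) - g (inr (wface Q (zigzag e))))).
  apply: eq_bigr => e _.
  by rewrite !zE bface_nextB wface_nextW opprB addrC addrA subrK.
rewrite sumrB; apply/eqP; rewrite subr_eq0; apply/eqP.
rewrite [LHS](reindex_inj (zigzag_inj (Q := Q))) /=.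
by apply: eq_bigl => e; rewrite fconnect_zigzag.
Qed.

Lemma flux_homologous c z z' : z \in cycles R Q -> z' \in cycles R Q ->
  homology_class Q z = homology_class Q z' -> flux c z = flux c z'.
Proof.
move=> zc z'c zz'; apply/eqP; rewrite -subr_eq0 -linearB; apply/eqP/flux_boundary.
by apply/homology_class_eq0; rewrite ?memvB // linearB /= zz' subrr.
Qed.

(** Evaluated on a chosen representative cycle; [flux_homologous] removes the dependence on the
    choice. *)
Definition flux_repr (c : A) (x : homology1 R Q) : R^o := flux c (vsval (repr x)).

Fact flux_repr_is_linear c : linear (flux_repr c).
Proof.
move=> k x y; rewrite /flux_repr -linearP /=.
have [xc xE] := homology_class_repr x; have [yc yE] := homology_class_repr y.
have [zc zE] := homology_class_repr (k *: x + y).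
by apply: flux_homologous; rewrite ?memvD ?memvZ // zE linearP /= xE yE.
Qed.

HB.instance Definition _ c :=
  GRing.isLinear.Build R (homology1 R Q) R^o _ (flux_repr c) (flux_repr_is_linear c).

Definition homology_flux (c : A) : 'Hom(homology1 R Q, R^o) := linfun (flux_repr c).

Lemma homology_fluxE c z : z \in cycles R Q ->
  homology_flux c (homology_class Q z) = flux c z.
Proof.
move=> zc; rewrite lfunE /= /flux_repr.
have [rc rE] := homology_class_repr (homology_class Q z).
exact: flux_homologous.
Qed.

(** Counts the arrows that are odd on the flow of [c] and even on the flow of [d]: the crossings of
    one sign. *)
Definition crossings (c d : A) : R :=
  \sum_(e | fconnect zigzag c e) (fconnect zigzag d (nextB Q e))%:R.

Lemma crossings_ge0 c d : 0 <= crossings c d.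
Proof. exact: sumr_ge0. Qed.

(** In the difference along each step, the contributions of arrows that are even on both flows
    cancel; the crossings of the two signs remain. *)
Lemma homology_flux_crossings c d :
  homology_flux c (zigzag_class d) = crossings c d - crossings d c.
Proof.
rewrite homology_fluxE ?zigzag_chain_cycle // /flux.
transitivity (\sum_(e | fconnect zigzag c e)
    ((fconnect zigzag d (nextB Q e))%:R - (fconnect zigzag d (prevB Q e))%:R) : R).
  by apply: eq_bigr => e _; rewrite !ffunE nextBK opprD addrA addrK.
rewrite sumrB; congr (_ - _); rewrite /crossings.
rewrite [LHS]big_mkcond [RHS]big_mkcond /= (reindex_inj (can_inj (nextBK Q))) /=.
by apply: eq_bigr => e _; rewrite nextBK; do 2 case: ifP.
Qed.

Lemma homology_flux_skew c d :
  homology_flux c (zigzag_class d) = - homology_flux d (zigzag_class c).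
Proof. by rewrite !homology_flux_crossings opprB. Qed.

Lemma crossings_gt0P c d :
  reflect (exists e, fconnect zigzag c e /\ fconnect zigzag d (nextB Q e))
          (0 < crossings c d).
Proof.
apply: (iffP idP) => [|[e [ce de]]].
  rewrite lt_def crossings_ge0 andbT => /eqP cr; apply: contrapT => no; apply: cr.
  rewrite /crossings big1 // => e ce.
  by case de: (fconnect _ d _) => //; case: no; exists e.
rewrite /crossings (bigD1 e) //= de ltr_pwDl ?ltr01 //.
by apply: sumr_ge0.
Qed.

Hypothesis conQ : connected_quiver Q.
Hypothesis euler : (#|V| + #|{: B + W}| = #|A|)%N.

(** * Intersection numbers as an area form *)

Section Coordinates.
Variables c0 d0 : A.
Hypothesis flux_gt0 : 0 < homology_flux c0 (zigzag_class d0) :> R.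
Local Notation J0 := (homology_flux c0).
Local Notation J1 := (homology_flux d0).

Lemma homology_flux_diag c : homology_flux c (zigzag_class c) = 0.
Proof. by rewrite homology_flux_crossings subrr. Qed.

(** Each functional vanishes on its own class but not on the other one. Hence the two classes are
    independent, fill the plane, and the functionals are coordinates on it. *)
Lemma homology_flux_inj x : J0 x = 0 -> J1 x = 0 -> x = 0.
Proof.
have p0 : J0 (zigzag_class d0) != 0 :> R by rewrite gt_eqF.
have q0 : J1 (zigzag_class c0) != 0 :> R.
  by rewrite homology_flux_skew oppr_eq0.
have freeE : \dim <<[:: zigzag_class c0; zigzag_class d0]>> = 2.
  suff : free [:: zigzag_class c0; zigzag_class d0] by move/eqP.
  rewrite free_cons; apply/andP; split; last first.
    by rewrite seq1_free; apply: contra_neq p0 => ->; rewrite linear0.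
  apply: contraNN q0; rewrite span_seq1 => /vlineP[k ->].
  by rewrite linearZ /= homology_flux_diag scaler0.
have : x \in <<[:: zigzag_class c0; zigzag_class d0]>>%VS.
  suff /eqP-> : <<[:: zigzag_class c0; zigzag_class d0]>>%VS == fullv by exact: memvf.
  by rewrite eqEdim subvf freeE (dim_homology1 R conQ euler).
rewrite span_cons span_seq1 => /memv_addP[_ /vlineP[k ->] [_ /vlineP[l ->] ->]].
rewrite !linearD !linearZ /= !homology_flux_diag !scaler0 add0r addr0.
move=> /eqP; rewrite scaler_eq0 (negbTE p0) orbF => /eqP->.
move=> /eqP; rewrite scaler_eq0 (negbTE q0) orbF => /eqP->.
by rewrite !scale0r addr0.
Qed.

(** Expand [x] in the classes of [d0] and [c0] and apply skew symmetry. The factor is positive, so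
    wedges and intersection numbers have the same sign. *)
Lemma wedge_zigzag c x :
  wedge J0 J1 (zigzag_class c) x = J0 (zigzag_class d0) * homology_flux c x :> R.
Proof.
have xE : (J0 (zigzag_class d0) : R) *: x =
    (J0 x : R) *: zigzag_class d0 - (J1 x : R) *: zigzag_class c0.
  apply/eqP; rewrite -subr_eq0; apply/eqP; apply: homology_flux_inj;
  rewrite !linearB /= !linearZ /= !homology_flux_diag /GRing.scale /=.
    by ring.
  by rewrite [J1 (zigzag_class c0)]homology_flux_skew; ring.
rewrite wedgeE; transitivity (homology_flux c ((J0 (zigzag_class d0) : R) *: x) : R).
  rewrite xE linearB !linearZ /= /GRing.scale /=.
  by rewrite [J0 _]homology_flux_skew [J1 (zigzag_class c)]homology_flux_skew; ring.
by rewrite linearZ.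
Qed.

End Coordinates.

(** * Signs of crossings and primitivity of classes *)

Variables X Y : A -> plane R.
Hypothesis detXY : forall a, 0 < det2 (X a) (Y a).
Hypothesis Y_nextB : forall a, Y (nextB Q a) = - X a.
Hypothesis X_nextW : forall a, X (nextW Q a) = - Y a.

Lemma X_zigzag c e : fconnect zigzag c e -> X e = X c.
Proof.
move=> /iter_findex <-; elim: (findex _ _ _) => //= n <-.
by rewrite X_nextW Y_nextB opprK.
Qed.

(** At the common arrow, [X] is the direction of [d] and [Y] is minus the direction of [c]; the quad
    there is positively oriented. *)
Lemma det2_crossing c d : 0 < crossings c d -> 0 < det2 (X c) (X d).
Proof.
move=> /crossings_gt0P[e [/X_zigzag <- /X_zigzag <-]].
have := detXY (nextB Q e); rewrite Y_nextB /det2 /= !mulrN opprK addrC.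
by rewrite [X in X - _]mulrC [X in _ - X]mulrC.
Qed.

Lemma det2_flux c d :
  0 < homology_flux c (zigzag_class d) :> R -> 0 < det2 (X c) (X d).
Proof.
rewrite homology_flux_crossings subr_gt0 => /(le_lt_trans (crossings_ge0 d c)).
exact: det2_crossing.
Qed.

(** A crossing of the opposite sign would reverse the determinant of the same two directions, so
    nothing is subtracted from the count. *)
Lemma flux_crossing c d e : fconnect zigzag c e -> fconnect zigzag d (nextB Q e) ->
  0 < homology_flux c (zigzag_class d) :> R.
Proof.
move=> ce de; have cd : 0 < crossings c d by apply/crossings_gt0P; exists e.
rewrite homology_flux_crossings; suff -> : crossings d c = 0 by rewrite subr0.
apply/eqP; rewrite eq_le crossings_ge0 andbT leNgt; apply/negP => /det2_crossing.
by have := det2_crossing cd; rewrite /det2; lra.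
Qed.

(** An arrow both even and odd on one flow would have [Y e = - X e], a degenerate quad. *)
Lemma zigzag_chain01 c e :
  (zigzag_chain c e = 1 /\ (fconnect zigzag c e \/ fconnect zigzag c (prevB Q e)))
  \/ zigzag_chain c e = 0.
Proof.
rewrite ffunE.
have [ce|] := boolP (fconnect zigzag c e); last first.
  move=> _; rewrite add0r; case pe: (fconnect _ c _); last by right.
  by left; split=> //; right.
left; case pe: (fconnect _ c _); last by rewrite addr0; split=> //; left.
have := detXY e; rewrite -{2}(prevBK Q e) Y_nextB (X_zigzag ce) (X_zigzag pe).
by rewrite /det2 /= mulrN [X in _ - X]mulrC mulNr opprK addrC subrr ltxx.
Qed.

(* Modulo [k], a primitive [g] of the chain of a flow differs by one between the
   black and the white faces along the flow and is constant off the flow, so it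
   takes two values; sending these to 0 and 1 gives an integral primitive. *)
Lemma zigzag_class_primitive c (k : nat) (v : homology1 R Q) :
  zigzag_class c != 0 -> integral_class v -> zigzag_class c = v *+ k -> k = 1%N.
Proof.
move=> cN0 [z [zc ->]] cE; set zR := [ffun a => (z a)%:~R] in zc cE.
have : zigzag_chain c - zR *+ k \in boundaries R Q.
  apply/(homology_class_eq0 _); last by rewrite linearB linearMn /= -cE subrr.
  by rewrite memvB ?zigzag_chain_cycle // rpredMn.
move=> /memv_boundaries[g gE]; pose s := g (inr (wface Q c)).
have {}gE a : zigzag_chain c a - (z a * k)%:~R =
    g (inl (bface Q a)) - g (inr (wface Q a)).
  by rewrite -gE !ffunE intrM mulr_natr ffunMnE ffunE.
pose low f := exists n : int, g f = s + (n * k)%:~R.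
pose high f := exists n : int, g f = s + 1 + (n * k)%:~R.
have on_flow a : zigzag_chain c a = 1 ->
    low (inr (wface Q a)) <-> high (inl (bface Q a)).
  move=> a1; have := gE a; rewrite a1 => E; split=> -[n gn].
    by exists (n - z a); rewrite mulrBl intrB; move: E; rewrite gn; lra.
  by exists (n + z a); rewrite mulrDl intrD; move: E; rewrite gn; lra.
have off_flow a : zigzag_chain c a = 0 ->
    (low (inr (wface Q a)) <-> low (inl (bface Q a))) /\
    (high (inr (wface Q a)) <-> high (inl (bface Q a))).
  move=> a0; have := gE a; rewrite a0 => E; split; split=> -[n gn].
  - by exists (n - z a); rewrite mulrBl intrB; move: E; rewrite gn; lra.
  - by exists (n + z a); rewrite mulrDl intrD; move: E; rewrite gn; lra.
  - by exists (n - z a); rewrite mulrBl intrB; move: E; rewrite gn; lra.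
  - by exists (n + z a); rewrite mulrDl intrD; move: E; rewrite gn; lra.
have chain1 e : fconnect zigzag c e -> zigzag_chain c e = 1.
  move=> ce; have [[]//|] := zigzag_chain01 c e.
  by rewrite ffunE ce => /eqP; rewrite paddr_eq0 ?ler0n ?ler01 // oner_eq0.
have chain1' e : fconnect zigzag c e -> zigzag_chain c (nextB Q e) = 1.
  move=> ce; have [[]//|] := zigzag_chain01 c (nextB Q e).
  rewrite ffunE nextBK ce => /eqP.
  by rewrite paddr_eq0 ?ler0n ?ler01 // oner_eq0 andbF.
have low_zigzag e : fconnect zigzag c e -> low (inr (wface Q e)).
  move=> /iter_findex <-; elim: (findex _ _ _) => [|n IHn].
    by exists 0; rewrite mul0r addr0.
  rewrite iterS; set e' := iter n zigzag c in IHn *.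
  have ce' : fconnect zigzag c e' by exact: fconnect_iter.
  rewrite wface_nextW; apply/(on_flow _ (chain1' _ ce')).
  by rewrite bface_nextB; apply/(on_flow _ (chain1 _ ce')).
have low_white e : zigzag_chain c e = 1 -> low (inr (wface Q e)).
  move=> e1; case: (zigzag_chain01 c e) => [[_ [/low_zigzag//|pe]]|].
    rewrite -(prevBK Q e) -(wface_nextW Q); apply: low_zigzag.
    by rewrite fconnect_zigzag.
  by rewrite e1 => /eqP; rewrite oner_eq0.
have low_high_arrow a : low (inl (bface Q a)) \/ high (inl (bface Q a)) <->
    low (inr (wface Q a)) \/ high (inr (wface Q a)).
  case: (zigzag_chain01 c a) => [[a1 _]|/off_flow[lo hi]].
    have lw := low_white a a1; split=> _; first by left.
    by right; apply/on_flow.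
  by rewrite lo hi.
have low_high_black a : low (inl (bface Q a)) \/ high (inl (bface Q a)).
  pose P a := low (inl (bface Q a)) \/ high (inl (bface Q a)).
  apply: (@connected_arrows _ _ _ _ Q P conQ _ _ c) => [b|b|]; rewrite /P.
  - by rewrite bface_nextB.
  - by rewrite !low_high_arrow wface_nextW.
  - by right; apply/(on_flow _ (chain1 _ (connect0 _ _)))/low_zigzag/connect0.
have low_high f : low f \/ high f.
  case: f => [b|w]; first by have [a <-] := bface_surj Q b.
  by have [a <-] := wface_surj Q w; apply/low_high_arrow.
apply: contrapT => k1; move/eqP: cN0; apply.
have exclusive f : low f -> high f -> False.
  move=> [m gm] [n gn]; apply: k1; rewrite gm in gn.
  have : ((m - n) * k)%:~R = 1%:~R :> R by rewrite mulrBl intrB; lra.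
  move=> /intr_inj mnk; have := dvdz_mull (m - n) (dvdzz k).
  by rewrite mnk dvdz1 => /eqP.
apply/homology_class_eq0; first exact: zigzag_chain_cycle.
apply/memv_boundaries; exists [ffun f => (`[< high f >])%:R] => a.
case: (zigzag_chain01 c a) => [[a1 _]|a0].
  have lw := low_white a a1; have hb := (on_flow a a1).1 lw.
  have nhw : ~ high (inr (wface Q a)) by exact: exclusive lw.
  by rewrite a1 !ffunE (asboolT hb) (asboolF nhw) subr0.
have [_ hi] := off_flow a a0.
by rewrite a0 !ffunE (asbool_equiv_eq hi) subrr.
Qed.

End ZigzagClasses.

(** * Flows in the universal cover *)

Section Flows.
Variables (R : realType) (V A B W : finType) (V' A' B' W' : Type).
Variables (Q' : surface_quiver V' A' B' W') (Q : surface_quiver V A B W).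
Variable p : quiver_map Q' Q.

Lemma mapA_prevB a : mapA p (prevB Q' a) = prevB Q (mapA p a).
Proof. by rewrite -[in RHS](prevBK Q' a) -map_nextB nextBK. Qed.

Lemma mapA_surj : connected_quiver Q -> forall (a' : A') c, exists a, mapA p a = c.
Proof.
move=> conQ a' c; pose P c := exists a, mapA p a = c.
apply: (@connected_arrows _ _ _ _ Q P conQ _ _ (mapA p a')) => [b|b|]; rewrite /P.
- split=> [[a <-]|[a ab]]; first by exists (nextB Q' a); rewrite -map_nextB.
  by exists (prevB Q' a); rewrite mapA_prevB ab nextBK.
- split=> [[a <-]|[a ab]]; first by exists (nextW Q' a); rewrite -map_nextW.
  exists (prevW Q' a); apply: (can_inj (nextWK Q)).
  by rewrite map_nextW prevWK.
- by exists a'.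
Qed.

Lemma int_bi_ind (P : int -> Prop) :
  P 0 -> (forall n, P n <-> P (n + 1)) -> forall n, P n.
Proof.
move=> P0 Pn; elim/int_ind => // n Pn'; first by rewrite -addn1 PoszD; apply: (Pn _).1.
by apply: (Pn _).2; rewrite -addn1 PoszD opprD subrK.
Qed.

(** A face of the cover has at most one corner at a vertex. Thus the conditions on a zig-zag flow
    determine each arrow from the preceding one. *)
Hypothesis black_corner_inj : forall a a',
  hd Q' a = hd Q' a' -> bface Q' a = bface Q' a' -> a = a'.
Hypothesis white_corner_inj : forall a a',
  hd Q' a = hd Q' a' -> wface Q' a = wface Q' a' -> a = a'.

Lemma zigzag_flow_odd eta n : zigzag_flow Q' eta ->
  eta (2 * n + 1) = nextB Q' (eta (2 * n)).
Proof.
move=> zf; have [hdtl _ _] := zf (2 * n); have [_ bb _] := zf n.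
rewrite -[LHS](prevBK Q'); congr (nextB Q' _); apply: black_corner_inj.
  by rewrite hd_prevB hdtl.
by rewrite bface_prevB.
Qed.

Lemma zigzag_flow_even eta n : zigzag_flow Q' eta ->
  eta (2 * n) = nextW Q' (eta (2 * n - 1)).
Proof.
move=> zf; have [hdtl _ _] := zf (2 * n - 1); have [_ _ ww] := zf n.
rewrite -[LHS](prevWK Q'); congr (nextW Q' _); apply: white_corner_inj.
  by rewrite hd_prevW hdtl subrK.
by rewrite wface_prevW.
Qed.

Lemma zigzag_flow_step eta n : zigzag_flow Q' eta ->
  eta (2 * (n + 1)) = zigzag Q' (eta (2 * n)).
Proof.
move=> zf; rewrite zigzag_flow_even // mulrDr mulr1 -addrA.
by rewrite zigzag_flow_odd.
Qed.

Lemma zigzag_flow_through a : exists2 eta, zigzag_flow Q' eta & eta 0 = a.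
Proof.
(* The even arrows, extended backwards by the inverse of [zigzag]; [Negz m] is [- (m + 1)], hence
   [m.+1] iterations. *)
pose f (n : int) := match n with
  | Posz m => iter m (zigzag Q') a
  | Negz m => iter m.+1 (prevB Q' \o prevW Q') a
  end.
have fS n : f (n + 1) = zigzag Q' (f n).
  case: n => n; first by rewrite -PoszD addn1.
  rewrite /= /zigzag prevBK prevWK NegzE -addn1 PoszD opprD subrK.
  by case: n => [|n] //; rewrite -NegzE.
pose eta (n : int) := if (n %% 2)%Z == 0 then f (n %/ 2)%Z else nextB Q' (f (n %/ 2)%Z).
have eta_even n : eta (2 * n) = f n by rewrite /eta mulrC modzMl mulzK.
have eta_odd n : eta (2 * n + 1) = nextB Q' (f n).
  by rewrite /eta mulrC modzMDl divzMDl // (_ : (1 %/ 2)%Z = 0) // addr0.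
have odd_pred n : 2 * n - 1 = 2 * (n - 1) + 1 :> int by lia.
have eta_pred n : eta (2 * n - 1) = prevW Q' (f n).
  by rewrite odd_pred eta_odd -[in RHS](subrK 1 n) fS nextWK.
exists eta => [n|]; last by rewrite -[X in eta X](mulr0 2) eta_even.
rewrite eta_even eta_odd eta_pred bface_nextB wface_prevW; split=> //.
have [->|->] : n = 2 * (n %/ 2)%Z \/ n = 2 * (n %/ 2)%Z + 1 by lia.
  by rewrite eta_even eta_odd tl_nextB.
set k := (n %/ 2)%Z; rewrite (_ : _ + 1 + 1 = 2 * (k + 1)); last by lia.
by rewrite eta_odd eta_even fS tl_nextW.
Qed.

Variables X Y : A -> plane R.
Hypothesis detXY : forall a, 0 < det2 (X a) (Y a).
Hypothesis Y_nextB : forall a, Y (nextB Q a) = - X a.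
Hypothesis X_nextW : forall a, X (nextW Q a) = - Y a.

Section OneFlow.
Variable eta : int -> A'.
Hypothesis zf : zigzag_flow Q' eta.
Let e n := mapA p (eta n).

Let e_odd n : e (2 * n + 1) = nextB Q (e (2 * n)).
Proof. by rewrite /e zigzag_flow_odd // map_nextB. Qed.

Let e_step n : e (2 * (n + 1)) = zigzag Q (e (2 * n)).
Proof. by rewrite /e zigzag_flow_step // /zigzag map_nextB map_nextW. Qed.

Let e_iter (m : nat) n : e (2 * (n + m%:Z)) = iter m (zigzag Q) (e (2 * n)).
Proof.
elim: m => [|m IHm]; first by rewrite addr0.
by rewrite -[m.+1]addn1 PoszD addrA e_step IHm addn1.
Qed.

Lemma flow_connect n : fconnect (zigzag Q) (mapA p (eta 0)) (mapA p (eta (2 * n))).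
Proof.
elim/int_bi_ind: n => [|n]; first exact: connect0.
by rewrite -/(e (2 * (n + 1))) e_step fconnect_zigzag.
Qed.

Let N := order (zigzag Q) (e 0).

Lemma flow_period_order : flow_period p eta (2 * N).
Proof.
split=> [|n]; first by rewrite muln_gt0 order_gt0.
have even k : e (2 * (k + N%:Z)) = e (2 * k).
  elim/int_bi_ind: k => [|k].
    by rewrite -[in LHS](mulr0 2) e_iter mulr0 iter_order //; exact: zigzag_inj.
  rewrite -addrA [1 + _]addrC addrA !e_step; split=> [->//|].
  exact: zigzag_inj.
rewrite -/(e (n + _)) -/(e n).
have [->|->] : n = 2 * (n %/ 2)%Z \/ n = 2 * (n %/ 2)%Z + 1 by lia.
  by rewrite PoszM -mulrDr even.
by rewrite PoszM addrAC -mulrDr !e_odd even.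
Qed.

(** An odd period would identify an even arrow with an odd one, contrary to the orientation of the
    quads. Half of an even period returns [zigzag] to its starting arrow, so it is at least the
    order [N]. *)
Lemma flow_period_min k : flow_period p eta k -> (2 * N <= k)%N.
Proof.
move=> [k0 kP]; have /(_ 0) := kP; rewrite add0r -/(e k) -/(e 0) => ek.
case: (boolP (odd k)) => kodd.
  have kE : k%:Z = 2 * (k./2)%:Z + 1 by lia.
  have := detXY (e 0); rewrite -{2}ek kE e_odd Y_nextB.
  rewrite (X_zigzag Y_nextB X_nextW (flow_connect _)) /det2 /= !mulrN opprK.
  by rewrite mulrC addrC subrr ltxx.
have kE : k%:Z = 2 * (0 + (k./2)%:Z) by lia.
rewrite kE e_iter mulr0 in ek.
suff : (N <= k./2)%N by lia.
rewrite leqNgt; apply/negP => lt_kN; have := findex_iter lt_kN.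
by rewrite ek findex0; lia.
Qed.

(** Pairing each even arrow with the odd one after it turns the period into a sum over the orbit of
    [zigzag], which has no repetitions. *)
Lemma flow_chainE :
  \sum_(i < 2 * N) arrow_chain R (mapA p (eta i%:Z)) = zigzag_chain R Q (mapA p (eta 0)).
Proof.
have -> : \sum_(i < 2 * N) arrow_chain R (mapA p (eta i%:Z)) =
    \sum_(j < N) (arrow_chain R (iter j (zigzag Q) (e 0)) +
                  arrow_chain R (nextB Q (iter j (zigzag Q) (e 0)))).
  elim: N => [|n IHn]; first by rewrite muln0 !big_ord0.
  rewrite mulnS !big_ord_recr /= IHn -addrA; congr (_ + (_ + _)).
    by rewrite -/(e _) PoszM -[X in e (2 * X)]add0r e_iter mulr0.
  have -> : (2 * n).+1 = 2 * (0 + n%:Z) + 1 :> int by lia.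
  by rewrite -/(e _) e_odd e_iter mulr0.
rewrite -(big_mkord predT (fun j => arrow_chain R (iter j (zigzag Q) (e 0)) +
   arrow_chain R (nextB Q (iter j (zigzag Q) (e 0))))) /=.
transitivity (\sum_(c <- orbit (zigzag Q) (e 0))
    (arrow_chain R c + arrow_chain R (nextB Q c))).
  rewrite (big_nth (e 0)) size_orbit [LHS]big_nat [RHS]big_nat.
  by apply: eq_bigr => i iN; rewrite nth_traject.
rewrite big_uniq ?orbit_uniq //=.
apply/ffunP => a; rewrite sum_ffunE !ffunE.
under eq_bigr do rewrite !ffunE.
rewrite big_split /=; congr (_ + _).
  rewrite big_mkcond (bigD1 a) //= eqxx -fconnect_orbit big1 ?addr0; first by case: ifP.
  by move=> c /negbTE ca; rewrite eq_sym ca; case: ifP.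
rewrite big_mkcond (bigD1 (prevB Q a)) //= prevBK eqxx -fconnect_orbit.
rewrite big1 ?addr0; first by case: ifP.
move=> c ca; rewrite -[a == _]negbK (_ : a != _); first by case: ifP.
by apply: contra_neq ca => ->; rewrite nextBK.
Qed.

Lemma flow_classP u : flow_class p eta u <-> u = zigzag_class R Q (mapA p (eta 0)).
Proof.
rewrite /zigzag_class -flow_chainE; split=> [[m [mP mmin ->]]|->]; last first.
  exists (2 * N)%N; split=> //; [exact: flow_period_order | exact: flow_period_min].
suff -> : m = (2 * N)%N by [].
apply/eqP; rewrite eqn_leq; apply/andP; split; last exact: flow_period_min.
exact: mmin flow_period_order.
Qed.

(** The two cases are [a] even and [a] odd on the flow; in the latter [prevB Q' a] is the even arrow
    before it. *)
Lemma flow_class_at a n u : eta n = a -> flow_class p eta u ->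
  u = zigzag_class R Q (mapA p a) \/ u = zigzag_class R Q (mapA p (prevB Q' a)).
Proof.
move=> <- /flow_classP ->.
have [->|->] : n = 2 * (n %/ 2)%Z \/ n = 2 * (n %/ 2)%Z + 1 by lia.
  by left; apply: zigzag_class_eq; exact: flow_connect.
by right; rewrite zigzag_flow_odd // nextBK; apply: zigzag_class_eq; exact: flow_connect.
Qed.

End OneFlow.
End Flows.

(** * Rhombi in the plane *)

Section PlaneGeometry.
Variable R : realType.
Implicit Types x y z b w h t : plane R.

Lemma plane_eq x y : x.1 = y.1 -> x.2 = y.2 -> x = y.
Proof. by case: x y => [? ?] [? ?] /= -> ->. Qed.

Lemma mem_open_hull2 x y (c d : R) : 0 < c -> 0 < d -> c + d = 1 ->
  open_hull [:: x; y] (c *: x + d *: y).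
Proof.
move=> c0 d0 cd; exists (fun i => [:: c; d]`_i); split.
- by case=> [[|[|[]]]].
- by rewrite !big_ord_recl big_ord0 /= addr0.
- by rewrite !big_ord_recl big_ord0 /= addr0.
Qed.

Lemma mem_open_hull4 x y z w v : open_hull [:: x; y; z; w] v <->
  exists c d e f : R, [/\ [/\ 0 < c, 0 < d, 0 < e & 0 < f], c + d + e + f = 1
    & v = c *: x + d *: y + e *: z + f *: w].
Proof.
split=> [[g [g0 g1 ->]]|[c [d [e [f [[c0 d0 e0 f0] cdef ->]]]]]].
  exists (g ord0), (g (lift ord0 ord0)), (g (lift ord0 (lift ord0 ord0))),
    (g (lift ord0 (lift ord0 (lift ord0 ord0)))).
  split=> //; first by rewrite -g1 !big_ord_recl big_ord0 /= addr0 !addrA.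
  by rewrite !big_ord_recl big_ord0 /= addr0 !addrA.
exists (fun i => [:: c; d; e; f]`_i); split.
- by case=> [[|[|[|[|[]]]]]].
- by rewrite !big_ord_recl big_ord0 /= addr0 !addrA.
- by rewrite !big_ord_recl big_ord0 /= addr0 !addrA.
Qed.

Lemma open_hull_rot2 x y z w : open_hull [:: x; y; z; w] = open_hull [:: z; w; x; y].
Proof.
suff sub x' y' z' w' : open_hull [:: x'; y'; z'; w'] `<=` open_hull [:: z'; w'; x'; y'].
  by apply/seteqP; split; exact: sub.
move=> v /mem_open_hull4[c [d [e [f [[c0 d0 e0 f0] cdef ->]]]]].
apply/mem_open_hull4; exists e, f, c, d; split=> //; first by lra.
by rewrite -[LHS]addrA [LHS]addrC [LHS]addrA.
Qed.

Definition dot x y : R := x.1 * y.1 + x.2 * y.2.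

Lemma edistE x y (l : R) : edist x y = l -> dot (x - y) (x - y) = l ^+ 2.
Proof. by move=> <-; rewrite sqr_sqrtr // addr_ge0 ?sqr_ge0. Qed.

Lemma dot_eq0 x : dot x x = 0 -> x = 0.
Proof.
move=> /eqP; rewrite /dot -!expr2 paddr_eq0 ?sqr_ge0 // !sqrf_eq0.
by move=> /andP[/eqP x1 /eqP x2]; exact: plane_eq.
Qed.

(** Orthogonality to [z] makes [x] and [y] parallel; the Lagrange identity for [dot] and [det2] then
    makes the product of their squared lengths vanish. *)
Lemma orthogonal_to_line x y z : z <> 0 ->
  dot x z = 0 -> dot y z = 0 -> dot x y = 0 -> x = 0 \/ y = 0.
Proof.
move=> z0 xz yz xy.
have det0 : det2 x y = 0.
  apply: contrapT => /eqP d0; apply: z0; apply: plane_eq; apply: (mulfI d0);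
    rewrite mulr0.
    transitivity (y.2 * dot x z - x.2 * dot y z); first by rewrite /det2 /dot; ring.
    by rewrite xz yz; ring.
  transitivity (x.1 * dot y z - y.1 * dot x z); first by rewrite /det2 /dot; ring.
  by rewrite xz yz; ring.
have : dot x x * dot y y = 0.
  transitivity (dot x y ^+ 2 + det2 x y ^+ 2); first by rewrite /dot /det2; ring.
  by rewrite xy det0; ring.
by move=> /eqP; rewrite mulf_eq0 => /orP[/eqP/dot_eq0|/eqP/dot_eq0]; [left | right].
Qed.

(* [h - t] and [b + w - t - h] are orthogonal to each other, and both are
   orthogonal to the diagonal [b - w]. *)
Lemma rhombus_parallelogram t b w h (l : R) :
  edist t b = l -> edist t w = l -> edist h b = l -> edist h w = l ->
  b <> w -> t <> h -> h - b = w - t.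
Proof.
move=> /edistE tb /edistE tw /edistE hb /edistE hw bw th.
rewrite /dot /= in tb tw hb hw.
have [| | | |ht|tE] := @orthogonal_to_line (h - t) (b + w - t - h) (b - w).
- by move=> /eqP; rewrite subr_eq0 => /eqP.
- by rewrite /dot /=; lra.
- by rewrite /dot /=; lra.
- by rewrite /dot /=; lra.
- by case: th; apply/esym/eqP; rewrite -subr_eq0 ht.
- move/eqP: tE; rewrite subr_eq0 => /eqP <-.
  by rewrite addrAC [b + w]addrC addrK.
Qed.

Lemma det2_cramer x y z : det2 x y *: z = det2 z y *: x + det2 x z *: y.
Proof. by apply: plane_eq; rewrite /det2 /= /GRing.scale /=; ring. Qed.

(** In the basis [x], [y] the vector [z] has coordinates [s], [t], both non-negative. If one
    vanishes, equal lengths make [z] a side; otherwise a short multiple of [z] points into the open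
    rhombus. *)
Lemma segment_in_corner b x y z (l : R) :
  0 < det2 x y -> 0 <= det2 x z -> 0 <= det2 z y ->
  dot x x = l ^+ 2 -> dot y y = l ^+ 2 -> dot z z = l ^+ 2 ->
  [\/ z = x, z = y |
      open_hull [:: b + z; b] `&` open_hull [:: b + x; b + x + y; b + y; b] !=set0].
Proof.
move=> xy xz zy xl yl zl.
have l0 : l ^+ 2 != 0.
  apply/eqP => l0; move: xy; rewrite (@dot_eq0 x) ?xl //.
  by rewrite /det2 !mul0r subrr ltxx.
pose s := det2 z y / det2 x y; pose t := det2 x z / det2 x y.
have s0 : 0 <= s by rewrite divr_ge0 // ltW.
have t0 : 0 <= t by rewrite divr_ge0 // ltW.
have zE : z = s *: x + t *: y.
  apply: (@scalerI _ _ (det2 x y)); first by rewrite gt_eqF.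
  by rewrite det2_cramer scalerDr !scalerA ![det2 x y * _]mulrC !divfK ?gt_eqF.
have side (k : R) (u v : plane R) : 0 <= k -> v = k *: u ->
    dot u u = l ^+ 2 -> dot v v = l ^+ 2 -> v = u.
  move=> k0 vE ul vl; suff k1 : k = 1 by rewrite vE k1 scale1r.
  have : k ^+ 2 * l ^+ 2 = 1 * l ^+ 2.
    by rewrite mul1r -{2}vl vE -ul /dot /= /GRing.scale /=; ring.
  by move=> /(mulIf l0)/eqP; rewrite sqrp_eq1 // => /eqP.
have [s00|sN0] := eqVneq s 0.
  by constructor 2; apply: (side t) => //; rewrite {1}zE s00 scale0r add0r.
have [t00|tN0] := eqVneq t 0.
  by constructor 1; apply: (side s) => //; rewrite {1}zE t00 scale0r addr0.
have {s0 sN0}s0 : 0 < s by rewrite lt_def sN0.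
have {t0 tN0}t0 : 0 < t by rewrite lt_def tN0.
(* Scaling by [k] leaves the positive weight [k] for the corner [b]. *)
constructor 3; pose k := (1 + s + t)^-1.
have st1 : 1 + s + t != 0 by lra.
have k0 : 0 < k by rewrite invr_gt0; lra.
have k1 : k + k * s + k * t = 1 by rewrite -[X in X + _ + _]mulr1 -!mulrDr mulVf.
have ks0 : 0 < k * s by rewrite mulr_gt0.
have kt0 : 0 < k * t by rewrite mulr_gt0.
(* The far corner also needs a positive weight: [m] is moved to it and to [b] from the two sides. *)
have [m [m0 mks mkt]] : exists m : R, [/\ 0 < m, m < k * s & m < k * t].
  have [le_st|lt_ts] := leP (k * s) (k * t).
    by exists (k * s / 2); split; lra.
  by exists (k * t / 2); split; lra.
exists (k *: (b + z) + (1 - k) *: b); split.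
  by apply: mem_open_hull2; lra.
apply/mem_open_hull4; exists (k * s - m), m, (k * t - m), (1 - k * s - k * t + m).
split; [by split; lra | by lra | rewrite zE].
by apply: plane_eq; rewrite /= /GRing.scale /=; ring.
Qed.

End PlaneGeometry.

(** * Rhombic embeddings *)

Section Embedding.
Variables (R : realType) (V A B W : finType) (V' A' B' W' : Type).
Variables (Q' : surface_quiver V' A' B' W') (Q : surface_quiver V A B W).
Variable p : quiver_map Q' Q.
Hypothesis no_monogon : forall a, nextB Q a <> a.
Variables (e1 e2 : plane R) (len : R) (pos : quad_vertex V' B' W' -> plane R).
Hypothesis rhombic : rhombic_embedding p e1 e2 len pos.

Local Notation tpos a := (pos (inl (tl Q' a))).
Local Notation hpos a := (pos (inl (hd Q' a))).
Local Notation bpos a := (pos (inr (inl (bface Q' a)))).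
Local Notation wpos a := (pos (inr (inr (wface Q' a)))).

Lemma cell_image_inj c c' :
  cell_image Q' pos c `&` cell_image Q' pos c' !=set0 -> c = c'.
Proof.
have [_ _ disj _ _] := rhombic; move=> [x xcc']; apply: contrapT => /disj cc'.
by have : set0 x by rewrite -cc'.
Qed.

Lemma open_segment_neq0 (x y : plane R) : open_hull [:: x; y] !=set0.
Proof.
exists (2^-1 *: x + 2^-1 *: y).
by apply: mem_open_hull2; rewrite ?invr_gt0 ?ltr0n //; lra.
Qed.

(** The image of an edge of the quad graph depends only on the positions of its ends, and distinct
    cells have disjoint images. *)
Lemma hpos_black_inj a a' : bface Q' a = bface Q' a' -> hpos a = hpos a' -> a = a'.
Proof.
move=> bb hh; suff : QEdgeB V' B' W' a = QEdgeB V' B' W' a' by case.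
apply: cell_image_inj; rewrite /cell_image /= bb hh setIid.
exact: open_segment_neq0.
Qed.

Lemma hpos_white_inj a a' : wface Q' a = wface Q' a' -> hpos a = hpos a' -> a = a'.
Proof.
move=> ww hh; suff : QEdgeW V' B' W' a = QEdgeW V' B' W' a' by case.
apply: cell_image_inj; rewrite /cell_image /= ww hh setIid.
exact: open_segment_neq0.
Qed.

Definition white_side a := wpos a - tpos a.
Definition black_side a := bpos a - tpos a.

Lemma det2_sides a : 0 < det2 (white_side a) (black_side a).
Proof. by have [_ + _ _ _] := rhombic; apply. Qed.

Lemma edist_hb a : edist (hpos a) (bpos a) = len.
Proof. by have [/(_ a)[]] := rhombic. Qed.

Lemma edist_hw a : edist (hpos a) (wpos a) = len.
Proof. by have [/(_ a)[]] := rhombic. Qed.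

Lemma edist_tb a : edist (tpos a) (bpos a) = len.
Proof. by rewrite -hd_prevB -bface_prevB edist_hb. Qed.

Lemma edist_tw a : edist (tpos a) (wpos a) = len.
Proof. by rewrite -hd_prevW -wface_prevW edist_hw. Qed.

(** Otherwise [prevB Q' a] and [a] would be the same corner, and [a] would project to a monogon. *)
Lemma tpos_neq_hpos a : tpos a <> hpos a.
Proof.
rewrite -hd_prevB => /hpos_black_inj; rewrite bface_prevB => /(_ erefl) pa.
by apply: (@no_monogon (mapA p a)); rewrite map_nextB -{1}pa prevBK.
Qed.

Lemma hb_white_side a : hpos a - bpos a = white_side a.
Proof.
apply: rhombus_parallelogram (edist_tb a) (edist_tw a) (edist_hb a) (edist_hw a) _ _.
  move=> bw; have := det2_sides a; rewrite /white_side /black_side bw.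
  by rewrite /det2 mulrC subrr ltxx.
exact: tpos_neq_hpos.
Qed.

Lemma hw_black_side a : hpos a - wpos a = black_side a.
Proof.
apply/eqP; rewrite subr_eq; apply/eqP.
by rewrite -[LHS](subrK (bpos a)) hb_white_side addrAC [RHS]addrAC [X in X - _]addrC.
Qed.

Lemma black_side_nextB a : black_side (nextB Q' a) = - white_side a.
Proof. by rewrite -hb_white_side opprB /black_side bface_nextB tl_nextB. Qed.

Lemma white_side_nextW a : white_side (nextW Q' a) = - black_side a.
Proof. by rewrite -hw_black_side opprB /white_side wface_nextW tl_nextW. Qed.

(** Lifts of one quad are translates of each other, so the sides descend to the arrows of [Q]. *)
Lemma sides_mapA a a' : mapA p a = mapA p a' ->
  white_side a = white_side a' /\ black_side a = black_side a'.
Proof.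
have [_ _ _ + _] := rhombic => /[apply] -[m [n]].
rewrite /translated_quad /= /white_side /black_side; set l := _ + _.
move=> [-> -> _ ->]; split; by rewrite opprD addrACA subrr addr0.
Qed.

Lemma dot_white_side a : dot (white_side a) (white_side a) = len ^+ 2.
Proof. by rewrite -hb_white_side; apply: edistE; exact: edist_hb. Qed.

Lemma dot_black_side a : dot (black_side a) (black_side a) = len ^+ 2.
Proof. by rewrite -hw_black_side; apply: edistE; exact: edist_hw. Qed.

(** The quad of [nextB Q' a] fills the angle at the black face between two consecutive corners. An
    edge to [a'] within that angle is one of its sides or enters the open quad, which disjointness
    of cells excludes. *)
Lemma black_corner a a' : bface Q' a = bface Q' a' ->
  0 <= det2 (white_side a) (white_side a') ->
  0 <= det2 (white_side a') (white_side (nextB Q' a)) ->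
  a' = a \/ a' = nextB Q' a.
Proof.
move=> ba dx dy; set c := nextB Q' a in dy *.
have xE : white_side a = - black_side c by rewrite black_side_nextB opprK.
have bc : bface Q' c = bface Q' a by exact: bface_nextB.
have cc : 0 < det2 (white_side a) (white_side c).
  by have := det2_sides c; rewrite xE /det2 /=; lra.
have [zx|zy|] := segment_in_corner (bpos a) cc dx dy
  (dot_white_side _) (dot_white_side _) (dot_white_side _).
- left; apply: hpos_black_inj; rewrite -?ba //.
  by apply: (@addIr _ (- bpos a)); rewrite hb_white_side -zx -hb_white_side ba.
- right; apply: hpos_black_inj; rewrite ?bc ?ba //.
  by apply: (@addIr _ (- bpos a)); rewrite -{2}bc hb_white_side -zy -hb_white_side ba.
have -> : open_hull [:: bpos a + white_side a'; bpos a] =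
    cell_image Q' pos (QEdgeB V' B' W' a').
  by rewrite /cell_image /= -hb_white_side -ba addrC subrK.
have -> : open_hull [:: bpos a + white_side a; bpos a + white_side a + white_side c;
                        bpos a + white_side c; bpos a] =
    cell_image Q' pos (QQuad V' B' W' c).
  have tE : bpos a + white_side a = tpos c.
    by rewrite xE /black_side bc opprB addrC subrK.
  have hE : bpos a + white_side c = hpos c by rewrite -hb_white_side bc addrC subrK.
  rewrite /cell_image /= hE tE bc; congr (open_hull [:: _; _; _; _]).
  by rewrite /white_side addrC subrK.
by move=> /cell_image_inj.
Qed.

(** As for black faces, but a white face is traversed clockwise: the next corner anticlockwise is
    [prevW Q' a], and the quad of [a] itself fills the angle. *)
Lemma white_corner a a' : wface Q' a = wface Q' a' ->
  0 <= det2 (black_side a) (black_side a') ->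
  0 <= det2 (black_side a') (black_side (prevW Q' a)) ->
  a' = a \/ a' = prevW Q' a.
Proof.
move=> wa dx dy; set c := prevW Q' a in dy *.
have yE : black_side c = - white_side a.
  by rewrite -[in RHS](prevWK Q' a) white_side_nextW opprK.
have wc : wface Q' c = wface Q' a by exact: wface_prevW.
have ac : 0 < det2 (black_side a) (black_side c).
  by have := det2_sides a; rewrite yE /det2 /=; lra.
have [zx|zy|] := segment_in_corner (wpos a) ac dx dy
  (dot_black_side _) (dot_black_side _) (dot_black_side _).
- left; apply: hpos_white_inj; rewrite -?wa //.
  by apply: (@addIr _ (- wpos a)); rewrite hw_black_side -zx -hw_black_side wa.
- right; apply: hpos_white_inj; rewrite ?wc ?wa //.
  by apply: (@addIr _ (- wpos a)); rewrite -{2}wc hw_black_side -zy -hw_black_side wa.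
have -> : open_hull [:: wpos a + black_side a'; wpos a] =
    cell_image Q' pos (QEdgeW V' B' W' a').
  by rewrite /cell_image /= -hw_black_side -wa addrC subrK.
have -> : open_hull [:: wpos a + black_side a; wpos a + black_side a + black_side c;
                        wpos a + black_side c; wpos a] =
    cell_image Q' pos (QQuad V' B' W' a).
  have tE : wpos a + black_side c = tpos a.
    by rewrite yE /white_side opprB addrC subrK.
  have hE : wpos a + black_side a = hpos a by rewrite -hw_black_side addrC subrK.
  rewrite /cell_image /= open_hull_rot2 tE hE; congr (open_hull [:: _; _; _; _]).
  by rewrite yE -hb_white_side opprB addrC subrK.
by move=> /cell_image_inj.
Qed.

End Embedding.

(** * Flows through the corners of a face *)

Section FaceCorners.
Variables (R : realType) (V A B W : finType) (V' A' B' W' : Type).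
Variables (Q' : surface_quiver V' A' B' W') (Q : surface_quiver V A B W).
Variable p : quiver_map Q' Q.
Hypothesis dimerQ : dimer_model_on_torus Q.
Variables (e1 e2 : plane R) (len : R) (pos : quad_vertex V' B' W' -> plane R).
Hypothesis rhombic : rhombic_embedding p e1 e2 len pos.

Let conQ : connected_quiver Q. Proof. by case: dimerQ. Qed.

Let euler : (#|V| + #|{: B + W}| = #|A|)%N. Proof. by case: dimerQ. Qed.

Let no_monogon a : nextB Q a <> a. Proof. by have [_ _ _ + _] := dimerQ; apply. Qed.

Variables (f : B' + W') (a0 : A').

Let lift (c : A) : A' := sval (cid (mapA_surj p conQ a0 c)).

Let liftK c : mapA p (lift c) = c. Proof. by rewrite /lift; case: cid. Qed.

(** Sides are read off on one chosen lift; by [sides_mapA] any lift gives the same vectors. *)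
Let X c := white_side Q' pos (lift c).

Let Y c := black_side Q' pos (lift c).

Let X_mapA a : X (mapA p a) = white_side Q' pos a.
Proof. by have [] := sides_mapA rhombic (liftK (mapA p a)). Qed.

Let Y_mapA a : Y (mapA p a) = black_side Q' pos a.
Proof. by have [] := sides_mapA rhombic (liftK (mapA p a)). Qed.

Let detXY c : 0 < det2 (X c) (Y c).
Proof. exact: det2_sides rhombic _. Qed.

Let Y_nextB c : Y (nextB Q c) = - X c.
Proof.
by rewrite -{1}(liftK c) map_nextB Y_mapA (black_side_nextB no_monogon rhombic).
Qed.

Let X_nextW c : X (nextW Q c) = - Y c.
Proof.
by rewrite -{1}(liftK c) map_nextW X_mapA (white_side_nextW no_monogon rhombic).
Qed.

Let black_corner_inj a a' :
  hd Q' a = hd Q' a' -> bface Q' a = bface Q' a' -> a = a'.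
Proof. by move=> hh /(hpos_black_inj rhombic); rewrite hh; apply. Qed.

Let white_corner_inj a a' :
  hd Q' a = hd Q' a' -> wface Q' a = wface Q' a' -> a = a'.
Proof. by move=> hh /(hpos_white_inj rhombic); rewrite hh; apply. Qed.

(* The corners of [f], anticlockwise, are identified with the arrows of its
   boundary; [even a] is the even arrow of the flow through the corner [a], and
   [even (nx a)] is the arrow of [f] which this flow shares with the flow through
   the next corner. *)
Variables even nx pv : A' -> A'.
Hypothesis f_nx : forall a, in_boundary Q' f a -> in_boundary Q' f (nx a).
Hypothesis f_pv : forall a, in_boundary Q' f a -> in_boundary Q' f (pv a).
Hypothesis pvK : cancel pv nx.
Hypothesis f_even : forall a, in_boundary Q' f a <->
  exists2 c, in_boundary Q' f c & a = even (nx c).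
Hypothesis even_nx : forall a,
  fconnect (zigzag Q) (mapA p (even a)) (mapA p (prevB Q' (even (nx a)))).
Hypothesis even_corner : forall a a',
  in_boundary Q' f a -> in_boundary Q' f a' ->
  0 <= det2 (white_side Q' pos (even a)) (white_side Q' pos (even a')) ->
  0 <= det2 (white_side Q' pos (even a')) (white_side Q' pos (even (nx a))) ->
  a' = a \/ a' = nx a.

Let u a : homology1 R Q := zigzag_class R Q (mapA p (even a)).

(** The shared arrow [even (nx a)] is odd on the flow through [a] and even on the next one, a
    positive crossing. *)
Let flux_nx a : 0 < homology_flux R Q (mapA p (even a)) (u (nx a)) :> R.
Proof.
apply: (flux_crossing detXY Y_nextB X_nextW (even_nx a)).
by rewrite map_nextB prevBK connect0.
Qed.

Let J0 := homology_flux R Q (mapA p (even a0)).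

Let J1 := homology_flux R Q (mapA p (even (nx a0))).

Let J_inj x : J0 x = 0 -> J1 x = 0 -> x = 0.
Proof. exact: (homology_flux_inj conQ euler (flux_nx a0)). Qed.

Let wedge_gt0 c x :
  (0 < wedge J0 J1 (zigzag_class R Q c) x :> R) = (0 < homology_flux R Q c x :> R).
Proof. by rewrite (wedge_zigzag conQ euler (flux_nx a0)) pmulr_rgt0 ?flux_nx. Qed.

Let wedge_nx a : in_boundary Q' f a -> 0 < wedge J0 J1 (u a) (u (nx a)) :> R.
Proof. by rewrite wedge_gt0. Qed.

Let th a := white_side Q' pos (even a).

Let det_th a a' : in_boundary Q' f a -> in_boundary Q' f a' ->
  0 < wedge J0 J1 (u a) (u a') :> R -> 0 < det2 (th a) (th a').
Proof.
rewrite wedge_gt0 /th -!X_mapA => _ _; exact: (det2_flux detXY Y_nextB X_nextW).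
Qed.

Let u_prevB a : zigzag_class R Q (mapA p (prevB Q' (even (nx a)))) = u a.
Proof. by apply/esym/zigzag_class_eq; exact: even_nx. Qed.

(** A flow uses a boundary arrow of [f] either as an even or as an odd arrow, which leaves the
    classes of two consecutive corners. *)
Let flow_class_corner eta n a v : zigzag_flow Q' eta -> eta n = even (nx a) ->
  flow_class p eta v -> v = u (nx a) \/ v = u a.
Proof.
move=> zf etan.
move=> /(flow_class_at black_corner_inj white_corner_inj detXY Y_nextB X_nextW zf etan).
by rewrite u_prevB.
Qed.

Variable S : set (set (homology1 R Q)).
Hypothesis local_fan : local_zigzag_fan p f S.

Let fanS : fan (@integral_class R V A B W Q) S. Proof. by case: local_fan. Qed.

Let completeS : complete S. Proof. by case: local_fan. Qed.

Let raysS s : (S s /\ cone_dim s 1) <->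
  exists a, in_boundary Q' f a /\ s = cone_of [:: u a].
Proof.
have [_ _ ->] := local_fan; split=> [[eta [v [zf [n fn] ev ->]]]|[a [fa ->]]].
  have [a fa nE] := (f_even _).1 fn; have [->|->] := flow_class_corner zf nE ev.
    by exists (nx a); split=> //; exact: f_nx.
  by exists a.
have [eta zf eta0] := zigzag_flow_through Q' (even a); exists eta, (u a).
split=> //; last first.
  apply/(flow_classP p black_corner_inj white_corner_inj detXY Y_nextB X_nextW zf).
  by rewrite eta0.
exists 0; rewrite eta0; apply/f_even; exists (pv a); first exact: f_pv.
by rewrite pvK.
Qed.

Let u_neq0 a : u a != 0.
Proof.
apply/eqP => ua0; have := flux_nx a.
by rewrite homology_flux_skew -/(u a) ua0 linear0 oppr0 ltxx.
Qed.

Lemma integral_zigzag_class c : integral_class (zigzag_class R Q c).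
Proof.
exists [ffun e => (fconnect (zigzag Q) c e)%:R + (fconnect (zigzag Q) c (prevB Q e))%:R].
set cR := [ffun a => _]; have -> : cR = zigzag_chain R Q c.
  by apply/ffunP => e; rewrite !ffunE intrD !mulrz_nat.
by split=> //; exact: zigzag_chain_cycle.
Qed.

Let flow_represents eta a s : zigzag_flow Q' eta ->
  zigzag_class R Q (mapA p (eta 0)) = u a -> s = cone_of [:: u a] ->
  representative_flow p s eta.
Proof.
move=> zf etaa ->; split=> //; exists (u a); split.
  by apply/(flow_classP p black_corner_inj white_corner_inj detXY Y_nextB X_nextW zf).
split=> //; [exact: integral_zigzag_class | exact/eqP |].
move=> k v; exact: (zigzag_class_primitive conQ detXY Y_nextB X_nextW (u_neq0 a)).
Qed.

Let consecutive_flows_intersect a : in_boundary Q' f a ->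
  exists eta theta : int -> A',
    [/\ representative_flow p (cone_of [:: u a]) eta,
        representative_flow p (cone_of [:: u (nx a)]) theta
      & intersect_in_boundary Q' f eta theta].
Proof.
move=> fa; have [eta zeta eta0] := zigzag_flow_through Q' (prevB Q' (even (nx a))).
have [theta ztheta theta0] := zigzag_flow_through Q' (even (nx a)).
exists eta, theta; split.
- by apply: (flow_represents (a := a)); rewrite ?eta0 ?u_prevB.
- by apply: (flow_represents (a := nx a)); rewrite ?theta0.
(* The first flow starts one step before the shared arrow, the second at it; hence the indices 1 and
   0. *)
exists (even (nx a)); split; [by apply/f_even; exists a | exists 1 | by exists 0].
have := zigzag_flow_odd black_corner_inj 0 zeta.
by rewrite mulr0 add0r eta0 prevBK.
Qed.

Lemma span_2dim_cone_iff gammap gammam :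
  ray (@integral_class R V A B W Q) gammap ->
  ray (@integral_class R V A B W Q) gammam -> gammap <> gammam ->
  span_2dim_cone S gammap gammam <->
  exists etap etam : int -> A',
    [/\ representative_flow p gammap etap,
        representative_flow p gammam etam
      & intersect_in_boundary Q' f etap etam].
Proof.
move=> rayp raym neq; split=> [span|].
  have [a [fa [[-> ->]|[-> ->]]]] := span_2dim_consecutive_flows J_inj f_nx f_pv
    pvK wedge_nx det_th even_corner fanS raysS rayp raym span.
    exact: consecutive_flows_intersect.
  have [eta [theta [reta rtheta [b [fb etab thetab]]]]] := consecutive_flows_intersect fa.
  by exists theta, eta; split=> //; exists b.
move=> [etap [etam [[zp [vp [cp gp]]] [zm [vm [cm gm]]] [b [fb [n nb] [m mb]]]]]].
have {gp}gpE : gammap = cone_of [:: vp] by case: gp.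
have {gm}gmE : gammam = cone_of [:: vm] by case: gm.
have [a fa bE] := (f_even b).1 fb; rewrite bE in nb mb.
have [span span'] := consecutive_flows_span_2dim J_inj f_nx f_pv
  pvK wedge_nx det_th even_corner fanS completeS raysS fa.
(* Each flow has one of two consecutive classes; equal classes would give equal rays. *)
have [vpE|vpE] := flow_class_corner zp nb cp;
  have [vmE|vmE] := flow_class_corner zm mb cm;
  rewrite vpE in gpE; rewrite vmE in gmE.
- by case: neq; exact: etrans gpE (esym gmE).
- by rewrite gpE gmE.
- by rewrite gpE gmE.
- by case: neq; exact: etrans gpE (esym gmE).
Qed.

End FaceCorners.

Theorem proposition4p15 (R : realType) (V A B W : finType)
    (Q : surface_quiver V A B W)
    (V' A' B' W' : Type) (Q' : surface_quiver V' A' B' W') (p : quiver_map Q' Q)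
    (hQ : dimer_model_on_torus Q) (hp : universal_cover p)
    (hgc : geometrically_consistent R p)
    (f : B' + W')
    (xi : set (set (homology1 R Q))) (hxi : local_zigzag_fan p f xi)
    (gammap gammam : set (homology1 R Q))
    (hgp : ray (@integral_class R V A B W Q) gammap)
    (hgm : ray (@integral_class R V A B W Q) gammam)
    (hne : gammap <> gammam) :
  span_2dim_cone xi gammap gammam <->
  exists etap etam : int -> A',
    [/\ representative_flow p gammap etap,
        representative_flow p gammam etam
      & intersect_in_boundary Q' f etap etam].
Proof.
have [e1 [e2 [len [pos [_ rhombic]]]]] := hgc.
have no_monogon a : nextB Q a <> a by have [_ _ _ + _] := hQ; apply.
case: f hxi => [b|w] hxi.
  have [a0 _] := bface_surj Q' b.
  (* Along a black face the flow through a corner has the arrow of that corner as an even arrow, and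
     [nextB] runs anticlockwise. *)
  apply: (span_2dim_cone_iff (even := id) (nx := nextB Q') (pv := prevB Q')
    hQ rhombic a0 _ _ _ _ _ _ hxi hgp hgm hne) => /=.
  - by move=> a; rewrite bface_nextB.
  - by move=> a; rewrite bface_prevB.
  - exact: prevBK.
  - move=> a; split=> [ba|[c bc ->]]; last by rewrite bface_nextB.
    by exists (prevB Q' a); rewrite ?bface_prevB ?prevBK.
  - by move=> a; rewrite nextBK connect0.
  - by move=> a a' <- /esym; exact: (black_corner no_monogon rhombic).
have [a0 _] := wface_surj Q' w.
(* At a white face the corner [a] is an odd arrow of its flow, so the even arrow is the one after
   it; anticlockwise order is given by [prevW]. *)
apply: (span_2dim_cone_iff (even := nextW Q') (nx := prevW Q') (pv := nextW Q')
  hQ rhombic a0 _ _ _ _ _ _ hxi hgp hgm hne) => /=.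
- by move=> a; rewrite wface_prevW.
- by move=> a; rewrite wface_nextW.
- exact: nextWK.
- move=> a; split=> [wa|[c wc ->]]; last by rewrite prevWK.
  by exists a; rewrite ?prevWK.
- move=> a; rewrite prevWK fconnect_sym; last exact: zigzag_inj.
  rewrite -(map_nextW p) -[X in nextW Q X](prevBK Q) -mapA_prevB fconnect_zigzag.
  exact: connect0.
(* The directions are minus the black sides; the signs cancel in each determinant. *)
- move=> a a' <- /esym wa; rewrite !(white_side_nextW no_monogon rhombic).
  rewrite /det2 /= !mulrNN -!/(det2 _ _); exact: (white_corner no_monogon rhombic).
Qed.
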